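(* Let $A$ be a complete noetherian local commutative ring with maximal ideal $\mathfrak{m}$, and write $A_i := A/\mathfrak{m}^{i+1}$ for $i \geq 0$. The following conditions are equivalent for an $A$-module $M$: (i) $M$ is flat and $\mathfrak{m}$-adically complete. (ii) There is an $\mathfrak{m}$-adic system of $A$-modules $\{ M_i \}_{i \in \mathbb{N}}$, such that $M_i$ is flat over $A_i$ for every $i$, and an isomorphism of $A$-modules $M \cong \varprojlim_i M_i$. (iii) $M$ is $\mathfrak{m}$-adically free.
   Context: Complete means $\mathfrak{m}$-adically complete; an $A$-module $N$ is $\mathfrak{m}$-adically complete if the canonical homomorphism $N \to \varprojlim_i (N/\mathfrak{m}^{i+1}N)$ is bijective. An $\mathfrak{m}$-adic system of $A$-modules is a collection $\{M_i\}_{i\in\mathbb{N}}$ of $A$-modules together with homomorphisms $\psi_i : M_{i+1} \to M_i$, such that for every $i$: $\mathfrak{m}^{i+1}M_i = 0$ (so $M_i$ is an $A_i$-module), and the $A_i$-linear homomorphism $A_i \otimes_{A_{i+1}} M_{i+1} \to M_i$ induced by $\psi_i$ is an isomorphism. For $a \in A$ put $\operatorname{ord}_{\mathfrak{m}}(a) := \sup\{ i \in \mathbb{N} \mid a \in \mathfrak{m}^i\}\in \mathbb{N}\cup\{\infty\}$. For a set $Z$, a function $f : Z \to A$ is decaying if for every $i \in \mathbb{N}$ the set $\{ z \in Z \mid \operatorname{ord}_{\mathfrak{m}}(f(z)) \leq i\}$ is finite; $\operatorname{F}_{\mathrm{dec}}(Z, A)$ is the $A$-module (pointwise operations) of decaying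 functions. An $A$-module is $\mathfrak{m}$-adically free if it is isomorphic to $\operatorname{F}_{\mathrm{dec}}(Z, A)$ for some set $Z$. *)

(* Defs.v *)
From HB Require Import structures.
From mathcomp Require Import all_boot all_order all_algebra generic_quotient ring_quotient.
From mathcomp Require Import boolp classical_sets functions cardinality.
From mathcomp.multinomials Require Import freeg.

Set Implicit Arguments.
Unset Strict Implicit.
Unset Printing Implicit Defensive.

Import GRing.Theory.

Local Open Scope ring_scope.
Local Open Scope quotient_scope.

(* Submodules and ideals are boolean predicates, as in ssralg and ring_quotient;
   the ones defined by a proposition go through [`[< _ >]]. *)

Section Span.
Variables (R : comNzRingType) (V : lmodType R).

Definition lspan (X : set V) : {pred V} := fun v =>
  `[< exists2 s : seq (R * V), (forall p, p \in s -> X p.2)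
        & v = \sum_(p <- s) p.1 *: p.2 >].

Lemma lspanP (X : set V) v :
  reflect (exists2 s : seq (R * V), (forall p, p \in s -> X p.2)
             & v = \sum_(p <- s) p.1 *: p.2) (v \in lspan X).
Proof. exact: asboolP. Qed.

Lemma lspan_submod_closed X : submod_closed (lspan X).
Proof.
split; first by apply/lspanP; exists [::] => //; rewrite big_nil.
move=> a u v /lspanP[s sX ->] /lspanP[t tX ->]; apply/lspanP.
exists ([seq (a * p.1, p.2) | p <- s] ++ t).
  by move=> p; rewrite mem_cat => /orP[/mapP[q /sX qX ->]|/tX].
rewrite big_cat big_map /= scaler_sumr; congr (_ + _).
by apply: eq_bigr => p _; rewrite scalerA.
Qed.

HB.instance Definition _ X :=
  GRing.isSubmodClosed.Build R V (lspan X) (lspan_submod_closed X).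

Lemma lspan_gen (X : set V) v : X v -> v \in lspan X.
Proof.
move=> Xv; apply/lspanP; exists [:: (1, v)].
  by move=> p; rewrite inE => /eqP ->.
by rewrite big_seq1 scale1r.
Qed.

Lemma lspan_sub (X : set V) (S : submodClosed V) :
  (forall v, X v -> v \in S) -> {subset lspan X <= S}.
Proof.
move=> XS v /lspanP[s sX ->]; rewrite big_seq; apply: rpred_sum => p /sX/XS.
exact: rpredZ.
Qed.

Definition idscale (I : {pred R}) (N : {pred V}) : {pred V} :=
  lspan [set v | exists a x, [/\ a \in I, x \in N & v = a *: x]]%classic.

HB.instance Definition _ I N := GRing.SubmodClosed.on (idscale I N).

End Span.

Section QuotientModule.
Variables (R : comNzRingType) (V : lmodType R).

(* submodClosed concerns semimodules, hence does not include closure under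
   opposites as a structure. *)
Definition submod_pred (S : submodClosed V) : {pred V} := fun x => x \in S.

Lemma submod_pred_zmod_closed S : zmod_closed (submod_pred S).
Proof. exact: (GRing.submod_closedB (submodClosedP S)). Qed.

HB.instance Definition _ S :=
  GRing.isZmodClosed.Build V (submod_pred S) (submod_pred_zmod_closed S).

Definition lquot (S : submodClosed V) : Type := Quotient.quot (submod_pred S).

Section Def.
Variable S : submodClosed V.

HB.instance Definition _ := GRing.Zmodule.on (lquot S).
HB.instance Definition _ := Quotient.on (lquot S).

Definition lproj (x : V) : lquot S := \pi_(lquot S) x.

Lemma lproj_eq x y : (lproj x = lproj y) <-> (x - y \in S).
Proof.
by rewrite (rwP eqP) /lproj (Quotient.idealrBE (submod_pred S)).
Qed.

Lemma lproj_repr (x : lquot S) : lproj (repr x) = x.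
Proof. exact: reprK. Qed.

Lemma lproj_surj (x : lquot S) : exists v, x = lproj v.
Proof. by exists (repr x); rewrite lproj_repr. Qed.

Lemma repr_lproj x : repr (lproj x) - x \in S.
Proof. by apply/lproj_eq; rewrite lproj_repr. Qed.

Lemma lproj_is_zmod : zmod_morphism lproj.
Proof. exact: (pi_is_zmod_morphism (Quotient.quot (submod_pred S))). Qed.

HB.instance Definition _ :=
  GRing.isZmodMorphism.Build V (lquot S) lproj lproj_is_zmod.

Definition lquot_scale (a : R) (x : lquot S) : lquot S :=
  lproj (a *: repr x).

Lemma lquot_scaleE a x : lquot_scale a (lproj x) = lproj (a *: x).
Proof. by apply/lproj_eq; rewrite -scalerBr rpredZ // repr_lproj. Qed.

Fact lquot_scaleA a b x : lquot_scale a (lquot_scale b x) = lquot_scale (a * b) x.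
Proof. by have [v ->] := lproj_surj x; rewrite !lquot_scaleE scalerA. Qed.

Fact lquot_scale1 : left_id 1 lquot_scale.
Proof. by move=> x; have [v ->] := lproj_surj x; rewrite lquot_scaleE scale1r. Qed.

Fact lquot_scaleDr : right_distributive lquot_scale +%R.
Proof.
move=> a x y; have [v ->] := lproj_surj x; have [w ->] := lproj_surj y.
by rewrite -raddfD !lquot_scaleE scalerDr raddfD.
Qed.

Fact lquot_scaleDl x : {morph lquot_scale^~ x : a b / a + b}.
Proof.
by move=> a b; have [v ->] := lproj_surj x; rewrite !lquot_scaleE scalerDl raddfD.
Qed.

HB.instance Definition _ := GRing.Zmodule_isLmodule.Build R (lquot S)
  lquot_scaleA lquot_scale1 lquot_scaleDr lquot_scaleDl.

Lemma lproj_is_scalable : scalable lproj.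
Proof. by move=> a x; rewrite -lquot_scaleE. Qed.

HB.instance Definition _ :=
  GRing.isScalable.Build R V (lquot S) _ lproj lproj_is_scalable.

(* The factorization of f through V / S; meaningful when f vanishes on S. *)
Definition lquot_lift (W : lmodType R) (f : V -> W) (x : lquot S) : W :=
  f (repr x).

Lemma lquot_liftE (W : lmodType R) (f : {linear V -> W}) :
  (forall x, x \in S -> f x = 0) -> forall x, lquot_lift f (lproj x) = f x.
Proof.
by move=> f0 x; apply/eqP; rewrite /lquot_lift -subr_eq0 -(linearB f) f0 // repr_lproj.
Qed.

Lemma lquot_lift_linear (W : lmodType R) (f : {linear V -> W}) :
  (forall x, x \in S -> f x = 0) -> linear (lquot_lift f).
Proof.
move=> f0 a x y; have [v ->] := lproj_surj x; have [w ->] := lproj_surj y.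
by rewrite -linearP !lquot_liftE // linearP.
Qed.

End Def.

Section Map.
Variables (S T : submodClosed V) (ST : {subset S <= T}).

Definition lquot_map of {subset S <= T} : lquot S -> lquot T :=
  lquot_lift (lproj T).

Lemma lquot_map_linear : linear (lquot_map ST).
Proof.
apply: lquot_lift_linear => x Sx; rewrite -(raddf0 (lproj T)).
by apply/lproj_eq; rewrite subr0 ST.
Qed.

HB.instance Definition _ := GRing.isLinear.Build R (lquot S) (lquot T) _
  (lquot_map ST) lquot_map_linear.
End Map.

End QuotientModule.

Section FreegLift.
Variables (R : comNzRingType) (K : choiceType) (P : lmodType R) (f : K -> P).

HB.instance Definition _ :=
  GRing.isZmodMorphism.Build {freeg K / R} P (fglift f) (lift_is_additive f).

Lemma freeg_monomial (a : R) (x : K) : << a *g x >> = a *: << x >> :> {freeg K / R}.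
Proof. by apply/eqP/freeg_eqP => y; rewrite coeffZ !coeffU mul1r. Qed.

Lemma fglift_is_scalable : scalable (fglift f : {freeg K / R} -> P).
Proof.
move=> a D; rewrite -[D]freeg_sumE scaler_sumr.
rewrite !(raddf_sum (fglift f)) scaler_sumr; apply: eq_bigr => z _.
rewrite /= liftU scalerA; have <- : << a * coeff z D *g z >> = a *: << coeff z D *g z >>.
  by apply/eqP/freeg_eqP => y; rewrite coeffZ !coeffU mulrA.
exact: liftU.
Qed.

HB.instance Definition _ :=
  GRing.isScalable.Build R {freeg K / R} P _ (fglift f) fglift_is_scalable.

End FreegLift.

Section Tensor.
Variables (R : comNzRingType) (V W : lmodType R).

Definition bilinear_map (P : lmodType R) (b : V -> W -> P) : Prop :=
  (forall w, linear (b^~ w)) /\ (forall v, linear (b v)).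

Definition tensor_rel : set {freeg (V * W) / R} := [set t |
  (exists a v v' w, t = << (a *: v + v', w) >> - a *: << (v, w) >> - << (v', w) >>)
  \/
  (exists a v w w', t = << (v, a *: w + w') >> - a *: << (v, w) >> - << (v, w') >>)
  ]%classic.

Definition tensor : Type := lquot (lspan tensor_rel).
HB.instance Definition _ := GRing.Lmodule.on tensor.

Definition pure_tensor (v : V) (w : W) : tensor :=
  lproj (lspan tensor_rel) << (v, w) >>.

Lemma pure_tensor_bilinear : bilinear_map pure_tensor.
Proof.
rewrite /pure_tensor; split=> [w a v v'|v a w w']; rewrite -linearP;
  apply/lproj_eq; apply/lspan_gen; rewrite opprD addrA; [left|right];
  by do 4!eexists.
Qed.

Section Lift.
Variables (P : lmodType R) (b : V -> W -> P) (b_bilin : bilinear_map b).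

Definition tensor_lift of bilinear_map b : tensor -> P :=
  lquot_lift (fglift (fun p => b p.1 p.2)).

Lemma tensor_rel_lift0 t : t \in lspan tensor_rel ->
  fglift (fun p => b p.1 p.2) t = 0.
Proof.
case: b_bilin => bl br /lspanP[s sX ->].
pose F : {linear {freeg (V * W) / R} -> P} := fglift (fun p => b p.1 p.2).
rewrite -[LHS]/(F _) linear_sum big_seq big1 // => p /sX.
have FU v w : F << (v, w) >> = b v w by rewrite /F /= liftU scale1r.
have FB : {morph F : x y / x - y} by exact: linearB.
have FZ a : {morph F : x / a *: x} by exact: linearZ.
move=> rel_p; rewrite FZ; suff -> : F p.2 = 0 by rewrite scaler0.
case: rel_p => -[a [v [w [w' ->]]]]; rewrite !FB FZ !FU.
  by rewrite bl -addrA -opprD subrr.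
by rewrite br -addrA -opprD subrr.
Qed.

Lemma tensor_lift_linear : linear (tensor_lift b_bilin).
Proof. exact: lquot_lift_linear tensor_rel_lift0. Qed.

HB.instance Definition _ := GRing.isLinear.Build R tensor P _
  (tensor_lift b_bilin) tensor_lift_linear.

Lemma tensor_liftE v w : tensor_lift b_bilin (pure_tensor v w) = b v w.
Proof.
rewrite /tensor_lift /pure_tensor.
by rewrite (lquot_liftE tensor_rel_lift0) /= liftU scale1r.
Qed.

End Lift.

Lemma tensor_ext (P : lmodType R) (f g : {linear tensor -> P}) :
  (forall v w, f (pure_tensor v w) = g (pure_tensor v w)) -> f =1 g.
Proof.
move=> fg t; have [D ->] := lproj_surj t; rewrite -[D]freeg_sumE !linear_sum.
apply: eq_bigr => -[v w] _ /=.
by rewrite freeg_monomial !linearZ /=; congr (_ *: _); apply: fg.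
Qed.

End Tensor.

Section Flat.
Variable R : comNzRingType.

Section TensorMap.
Variables (N N' M : lmodType R) (f : {linear N -> N'}).

Lemma tensor_map_bilinear :
  bilinear_map (fun (n : N) (x : M) => pure_tensor (f n) x).
Proof.
have [bl br] := pure_tensor_bilinear N' M; split=> [x a n n'|n a x x'] /=.
  by rewrite linearP bl.
by rewrite br.
Qed.

Definition tensor_map : tensor N M -> tensor N' M :=
  tensor_lift tensor_map_bilinear.

HB.instance Definition _ := GRing.Linear.on tensor_map.

Lemma tensor_mapE n x : tensor_map (pure_tensor n x) = pure_tensor (f n) x.
Proof. exact: tensor_liftE. Qed.

End TensorMap.

Arguments tensor_map {N N'} M f _.

Definition flat (M : lmodType R) : Prop :=
  forall (N N' : lmodType R) (f : {linear N -> N'}),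
    injective f -> injective (tensor_map M f).

End Flat.

Arguments tensor_map {R N N'} M f _.

Section BaseChange.
Variables (R S : comNzRingType) (rho : {rmorphism R -> S}).

Definition restr (_ : {rmorphism R -> S}) (N : lmodType S) : Type := N.

Section Restr.
Variable N : lmodType S.

HB.instance Definition _ := GRing.Zmodule.on (restr rho N).

Definition restr_scale (a : R) (x : restr rho N) : restr rho N :=
  rho a *: (x : N).

Fact restr_scaleA a b x : restr_scale a (restr_scale b x) = restr_scale (a * b) x.
Proof. by rewrite /restr_scale scalerA rmorphM. Qed.

Fact restr_scale1 : left_id 1 restr_scale.
Proof. by move=> x; rewrite /restr_scale rmorph1 scale1r. Qed.

Fact restr_scaleDr : right_distributive restr_scale +%R.
Proof. by move=> a x y; apply: scalerDr. Qed.

Fact restr_scaleDl x : {morph restr_scale^~ x : a b / a + b}.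
Proof. by move=> a b; rewrite /restr_scale rmorphD; apply: scalerDl. Qed.

HB.instance Definition _ := GRing.Zmodule_isLmodule.Build R (restr rho N)
  restr_scaleA restr_scale1 restr_scaleDr restr_scaleDl.

End Restr.

Variables (M : lmodType R) (N : lmodType S) (psi : {linear M -> restr rho N}).

Definition base_change_fun (s : restr rho S^o) (x : M) : restr rho N :=
  (s : S) *: (psi x : N).

Lemma base_change_bilinear : bilinear_map base_change_fun.
Proof.
split=> [x a s s'|s a x x'] /=; rewrite /base_change_fun.
  by rewrite [LHS]scalerDl -scalerA.
rewrite linearP [LHS]scalerDr; congr (_ + _).
by rewrite [LHS]scalerA mulrC -[LHS]scalerA.
Qed.

Definition base_change_map : tensor (restr rho S^o) M -> N :=
  tensor_lift base_change_bilinear.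

Lemma base_change_mapE s x :
  base_change_map (pure_tensor (s : restr rho S^o) x) = (s : S) *: (psi x : N).
Proof. exact: (tensor_liftE base_change_bilinear). Qed.

End BaseChange.

Section QuotientRing.
Variable A : comNzRingType.

Definition annihilates (I : {pred A}) (M : lmodType A) : Prop :=
  forall a (x : M), a \in I -> a *: x = 0.

Definition quot_module (I : idealr A) (M : lmodType A) of annihilates I M : Type :=
  M.

Section Module.
Variables (I : idealr A) (M : lmodType A) (IM0 : annihilates I M).

HB.instance Definition _ := GRing.Zmodule.on (quot_module IM0).

Definition quot_module_scale (a : {ideal_quot I}) (x : quot_module IM0) :
  quot_module IM0 := repr a *: (x : M).

Lemma quot_module_scaleE (a : A) x :
  quot_module_scale (\pi_({ideal_quot I}) a) x = a *: (x : M).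
Proof.
apply/eqP; rewrite -subr_eq0 -[X in X == _](@scalerBl A M); apply/eqP/IM0.
by rewrite Quotient.idealrBE reprK.
Qed.

Fact quot_module_scaleA a b x :
  quot_module_scale a (quot_module_scale b x) = quot_module_scale (a * b) x.
Proof.
rewrite -[a]reprK -[b]reprK -rmorphM !quot_module_scaleE; exact: scalerA.
Qed.

Fact quot_module_scale1 : left_id 1 quot_module_scale.
Proof.
move=> x; rewrite -(rmorph1 \pi_({ideal_quot I})) quot_module_scaleE.
exact: scale1r.
Qed.

Fact quot_module_scaleDr : right_distributive quot_module_scale +%R.
Proof. by move=> a x y; apply: scalerDr. Qed.

Fact quot_module_scaleDl x : {morph quot_module_scale^~ x : a b / a + b}.
Proof.
move=> a b; rewrite -[a]reprK -[b]reprK -rmorphD !quot_module_scaleE.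
exact: scalerDl.
Qed.

HB.instance Definition _ := GRing.Zmodule_isLmodule.Build {ideal_quot I}
  (quot_module IM0) quot_module_scaleA quot_module_scale1 quot_module_scaleDr
  quot_module_scaleDl.

End Module.

Section Map.
Variables (I J : idealr A) (IJ : {subset I <= J}).

Definition quot_ring_map of {subset I <= J} : {ideal_quot I} -> {ideal_quot J} :=
  fun a => \pi_({ideal_quot J}) (repr a).

Lemma quot_ring_mapE a :
  quot_ring_map IJ (\pi_({ideal_quot I}) a) = \pi_({ideal_quot J}) a.
Proof. by apply/eqP; rewrite -Quotient.idealrBE IJ // Quotient.idealrBE reprK. Qed.

Fact quot_ring_map_zmod : zmod_morphism (quot_ring_map IJ).
Proof.
move=> a b; rewrite -[a]reprK -[b]reprK -rmorphB !quot_ring_mapE.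
exact: rmorphB.
Qed.

Fact quot_ring_map_monoid : monoid_morphism (quot_ring_map IJ).
Proof.
split=> [|a b]; first by rewrite -(rmorph1 \pi_({ideal_quot I})) quot_ring_mapE rmorph1.
rewrite -[a]reprK -[b]reprK -rmorphM !quot_ring_mapE.
exact: rmorphM.
Qed.

HB.instance Definition _ := GRing.isZmodMorphism.Build {ideal_quot I}
  {ideal_quot J} (quot_ring_map IJ) quot_ring_map_zmod.
HB.instance Definition _ := GRing.isMonoidMorphism.Build {ideal_quot I}
  {ideal_quot J} (quot_ring_map IJ) quot_ring_map_monoid.

Variables (M N : lmodType A) (IM0 : annihilates I M) (JN0 : annihilates J N).
Variable f : {linear M -> N}.

Definition quot_module_map (x : quot_module IM0) :
  restr (quot_ring_map IJ) (quot_module JN0) := f x.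

Lemma quot_module_map_linear : linear quot_module_map.
Proof.
move=> a x y; transitivity (repr a *: f x + f y : N); first exact: linearP.
congr (_ + _ : N); symmetry.
exact: (@quot_module_scaleE J N JN0 (repr a) (f x)).
Qed.

HB.instance Definition _ := GRing.isLinear.Build {ideal_quot I} (quot_module IM0)
  (restr (quot_ring_map IJ) (quot_module JN0)) _ quot_module_map
  quot_module_map_linear.

End Map.

End QuotientRing.

Arguments quot_module_map {A I J} IJ {M N} IM0 JN0 f _.

Section Ideals.
Variable A : comNzRingType.

Definition noetherian : Prop :=
  forall I : {pred A^o}, submod_closed I ->
    exists s : seq A^o, I =i lspan [set a | a \in s]%classic.

Definition maximal_ideal (I : idealr A) : Prop :=
  forall J : idealr A, {subset I <= J} -> J =i I.

Definition local_with (m : idealr A) : Prop :=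
  maximal_ideal m /\ forall J : idealr A, maximal_ideal J -> J =i m.

Fixpoint idpow (I : {pred A}) (n : nat) : {pred A} :=
  if n is n'.+1 then idscale (V := A^o) I (idpow I n') else predT.

Lemma idpow_submod I n : submod_closed (idpow I n : {pred A^o}).
Proof. by case: n => [|n]; [|exact: lspan_submod_closed]. Qed.

Lemma idpowS_sub I n : {subset idpow I n.+1 <= idpow I n}.
Proof.
have [S0 Slin] := idpow_submod I n.
move=> x /lspanP[s sX ->]; rewrite big_seq.
elim/big_ind: _ => // [u v Su Sv|p /sX[a [y [_ Iy ->]]]].
  by rewrite -[u]scale1r; apply: Slin.
by rewrite scalerA -[X in X \in _]addr0; apply: Slin.
Qed.

Lemma idpow_sub I n k : (k <= n)%N -> {subset idpow I n <= idpow I k}.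
Proof.
elim: n => [|n IHn]; first by rewrite leqn0 => /eqP ->.
rewrite leq_eqVlt => /predU1P[->//|/IHn sub] x /idpowS_sub; exact: sub.
Qed.

Lemma idpow1_sub (I : idealr A) : {subset idpow I 1 <= I}.
Proof.
move=> x /lspanP[s sX ->]; rewrite big_seq.
apply: rpred_sum => p /sX[a [y [Ia _ ->]]].
by rewrite -[_ *: _]/(p.1 * (a * y)) [a * y]mulrC mulrA idealMr.
Qed.

(* The proper ideal m^(i+1); only positive powers are proper, whence the shift. *)
Definition idpowS (m : idealr A) (i : nat) : {pred A} := idpow m i.+1.

Lemma idpowS_idealr_closed m i : idealr_closed (idpowS m i).
Proof.
have [S0 Slin] := idpow_submod m i.+1; split=> //.
by apply/negP => /(@idpow_sub m i.+1 1 isT)/idpow1_sub; rewrite idealr1.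
Qed.

HB.instance Definition _ m i :=
  isIdealr.Build A (idpowS m i) (idpowS_idealr_closed m i).

Lemma idpowS_subS m i : {subset idpowS m i.+1 <= idpowS m i}.
Proof. exact: idpowS_sub. Qed.

End Ideals.

Section InverseLimit.
Variable R : comNzRingType.

Definition dprod (X : nat -> lmodType R) : Type := forall i, X i.

Section Product.
Variable X : nat -> lmodType R.
Implicit Types x y z : dprod X.

HB.instance Definition _ := gen_eqMixin (dprod X).
HB.instance Definition _ := gen_choiceMixin (dprod X).

Definition dprod_zero : dprod X := fun=> 0.
Definition dprod_opp x : dprod X := fun i => - x i.
Definition dprod_add x y : dprod X := fun i => x i + y i.
Definition dprod_scale (a : R) x : dprod X := fun i => a *: x i.

Fact dprod_addA : associative dprod_add.
Proof. by move=> x y z; apply: functional_extensionality_dep => i; apply: addrA. Qed.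
Fact dprod_addC : commutative dprod_add.
Proof. by move=> x y; apply: functional_extensionality_dep => i; apply: addrC. Qed.
Fact dprod_add0 : left_id dprod_zero dprod_add.
Proof. by move=> x; apply: functional_extensionality_dep => i; apply: add0r. Qed.
Fact dprod_addN : left_inverse dprod_zero dprod_opp dprod_add.
Proof. by move=> x; apply: functional_extensionality_dep => i; apply: addNr. Qed.

HB.instance Definition _ :=
  GRing.isZmodule.Build (dprod X) dprod_addA dprod_addC dprod_add0 dprod_addN.

Fact dprod_scaleA a b x : dprod_scale a (dprod_scale b x) = dprod_scale (a * b) x.
Proof. by apply: functional_extensionality_dep => i; apply: scalerA. Qed.
Fact dprod_scale1 : left_id 1 dprod_scale.
Proof. by move=> x; apply: functional_extensionality_dep => i; apply: scale1r. Qed.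
Fact dprod_scaleDr : right_distributive dprod_scale +%R.
Proof. by move=> a x y; apply: functional_extensionality_dep => i; apply: scalerDr. Qed.
Fact dprod_scaleDl x : {morph dprod_scale^~ x : a b / a + b}.
Proof. by move=> a b; apply: functional_extensionality_dep => i; apply: scalerDl. Qed.

HB.instance Definition _ := GRing.Zmodule_isLmodule.Build R (dprod X)
  dprod_scaleA dprod_scale1 dprod_scaleDr dprod_scaleDl.

End Product.

Variables (X : nat -> lmodType R) (f : forall i, {linear X i.+1 -> X i}).

Definition compatible : {pred dprod X} :=
  fun x => `[< forall i, f i (x i.+1) = x i >].

Lemma compatible_submod_closed : submod_closed compatible.
Proof.
split=> [|a x y /asboolP xf /asboolP yf]; apply/asboolP => i; first exact: raddf0.
by rewrite [LHS]linearP xf yf.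
Qed.

HB.instance Definition _ :=
  GRing.isSubmodClosed.Build R (dprod X) compatible compatible_submod_closed.

Record invlim := InvLim { invlim_val :> dprod X ; _ : invlim_val \in compatible }.

HB.instance Definition _ := [isSub for invlim_val].
HB.instance Definition _ := [Choice of invlim by <:].
HB.instance Definition _ := [SubChoice_isSubLmodule of invlim by <:].

End InverseLimit.

Section Completeness.
Variables (A : comNzRingType) (m : idealr A) (N : lmodType A).

Definition pow_submod (i : nat) : {pred N} := idscale (idpow m i) predT.
HB.instance Definition _ i := GRing.SubmodClosed.on (pow_submod i).

Lemma pow_submodS_sub i : {subset pow_submod i.+1 <= pow_submod i}.
Proof.
apply: lspan_sub => x [a [y [ma _ ->]]]; apply: lspan_gen.
by exists a, y; split=> //; apply: idpowS_sub.
Qed.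

Definition adic_quot (i : nat) : lmodType A := lquot (pow_submod i.+1).

Definition adic_quot_map (i : nat) : {linear adic_quot i.+1 -> adic_quot i} :=
  lquot_map (@pow_submodS_sub i.+1).

Lemma adic_canon_compatible (x : N) :
  (fun i => lproj (pow_submod i.+1) x : adic_quot i) \in compatible adic_quot_map.
Proof.
by apply/asboolP => i; apply/lproj_eq/pow_submodS_sub/repr_lproj.
Qed.

Definition adic_canon (x : N) : invlim adic_quot_map :=
  InvLim (adic_canon_compatible x).

Lemma adic_canon_linear : linear adic_canon.
Proof.
move=> a x y; apply: val_inj; apply: functional_extensionality_dep => i /=.
exact: linearP.
Qed.

HB.instance Definition _ :=
  GRing.isLinear.Build A N (invlim adic_quot_map) _ adic_canon adic_canon_linear.

Definition adically_complete : Prop := bijective adic_canon.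

End Completeness.

Section AdicSystem.
Variables (A : comNzRingType) (m : idealr A).

(* The homomorphism A_i (x)_{A_(i+1)} M_(i+1) -> M_i induced by psi_i, where
   A_i = A / m^(i+1). *)
Definition sys_induced (M : nat -> lmodType A)
    (psi : forall i, {linear M i.+1 -> M i})
    (ann : forall i, annihilates (idpowS m i) (M i)) (i : nat) :
    tensor (restr (quot_ring_map (@idpowS_subS A m i)) {ideal_quot (idpowS m i)}^o)
      (quot_module (ann i.+1)) -> quot_module (ann i) :=
  base_change_map (quot_module_map (@idpowS_subS A m i) (ann i.+1) (ann i) (psi i)
    : {linear quot_module (ann i.+1) ->
         restr (quot_ring_map (@idpowS_subS A m i)) (quot_module (ann i))}).

Arguments sys_induced {M} psi ann i _.

Record adic_system := AdicSystem {
  sys_mod : nat -> lmodType A;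
  sys_map : forall i, {linear sys_mod i.+1 -> sys_mod i};
  sys_ann : forall i, annihilates (idpowS m i) (sys_mod i);
  sys_base_change : forall i, bijective (sys_induced sys_map sys_ann i)
}.

End AdicSystem.

Arguments sys_induced {A m M} psi ann i _.
Arguments sys_mod {A m} _ _.
Arguments sys_map {A m} _ _.
Arguments sys_ann {A m} _ _ _ _ _.
Arguments sys_base_change {A m} _ _.

Section Decaying.
Variables (A : comNzRingType) (m : idealr A).

(* The supremum of S in N u {oo}, with None standing for oo. *)
Definition enat_sup (S : set nat) : option nat :=
  if pselect (exists b, `[< forall i, S i -> (i <= b)%N >]) is left bounded
  then Some (ex_minn bounded) else None.

Definition enat_le (x : option nat) (n : nat) : bool :=
  if x is Some k then (k <= n)%N else false.

Definition ord (a : A) : option nat := enat_sup [set i | a \in idpow m i]%classic.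

Lemma ord_leP a i : enat_le (ord a) i <-> a \notin idpow m i.+1.
Proof.
rewrite /ord /enat_sup; case: pselect => [h|h] /=; last first.
  split=> // /negP nma; case: h; exists i; apply/asboolP => j /= mj.
  rewrite leqNgt; apply/negP => lt_ij; apply: nma; exact: (idpow_sub lt_ij).
case: ex_minnP => b /asboolP ubb minb; split=> [le_bi|nma].
  by apply/negP => mi; have := ubb i.+1 mi; rewrite leqNgt ltnS le_bi.
apply: minb; apply/asboolP => j /= mj; rewrite leqNgt; apply/negP => lt_ij.
by move/negP: nma; apply; apply: (idpow_sub lt_ij).
Qed.

Variable Z : Type.

Definition decaying : {pred Z -> A^o} := fun f =>
  `[< forall i, finite_set [set z | enat_le (ord (f z)) i]%classic >].

Lemma decaying_submod_closed : submod_closed decaying.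
Proof.
have pow i := idpow_submod m i.
split=> [|a f g /asboolP fd /asboolP gd]; apply/asboolP => i.
  apply: sub_finite_set (finite_set0 Z) => z /= /ord_leP /negP; apply.
  by have [] := pow i.+1.
apply: (@sub_finite_set _ _ ([set z | enat_le (ord (f z)) i] `|`
                             [set z | enat_le (ord (g z)) i])%classic); last first.
  by rewrite finite_setU.
move=> z /= /ord_leP /negP nfg.
have [|/negP nf] := boolP (f z \in idpow m i.+1); last by left; apply/ord_leP/negP.
move=> mf; right; apply/ord_leP/negP => mg; apply: nfg.
by have [_] := pow i.+1; apply.
Qed.

HB.instance Definition _ :=
  GRing.isSubmodClosed.Build A (Z -> A^o) decaying decaying_submod_closed.

Record Fdec := DecayingFun { Fdec_val :> Z -> A^o ; _ : Fdec_val \in decaying }.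

HB.instance Definition _ := [isSub for Fdec_val].
HB.instance Definition _ := [Choice of Fdec by <:].
HB.instance Definition _ := [SubChoice_isSubLmodule of Fdec by <:].

End Decaying.

Definition lmod_iso (R : comNzRingType) (M N : lmodType R) : Prop :=
  exists f : {linear M -> N}, bijective f.

Definition adically_free (A : comNzRingType) (m : idealr A) (M : lmodType A) : Prop :=
  exists Z : Type, lmod_iso M (Fdec m Z).

(* Main.v *)
From HB Require Import structures.
Require Import Defs.
From mathcomp Require Import all_boot all_order all_algebra generic_quotient ring_quotient.
From mathcomp Require Import boolp classical_sets functions cardinality.
From mathcomp.multinomials Require Import freeg.
Set Implicit Arguments.
Unset Strict Implicit.
Unset Printing Implicit Defensive.
Import GRing.Theory.
Local Open Scope ring_scope.
Local Open Scope quotient_scope.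

(** Flatness is handled through linear relations: a module over R is flat exactly
when every relation a_1 x_1 + ... + a_n x_n = 0 in it is trivial, that is, x = b y
for a matrix b over R with a b = 0 and finitely many elements y_j. Asking only
that the entries of a b lie in an ideal I of A turns this into a description,
over A alone, of flatness over A / I ([flat_quotP]); this is what makes it
possible to work with all the rings A / m^(i+1) at once.

From a flat complete M the system is M / m^(i+1) M. A relation there lifts to a
relation in M after adding terms with coefficients in m^(i+1), and trivializing
the lifted relation trivializes the original one ([adic_quot_trivial_relations]).

Given a system M_i of flat modules, lift a basis Z of the vector space M_0 to
compatible families x_i : Z -> M_i. They span M_i because M_i is spanned modulo
m M_i and m is nilpotent on M_i ([lift_span]). Suppose a x = 0; trivialize it as
x = b y, expand y = c x' in the spanning family, and compare with the basis of
M_0: the matrix b c is the identity modulo m, whereas a b c = 0 modulo m^(i+1).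
Hence if the entries of a lie in m^k, they lie in m^(k+1), up to k = i
([lift_free]). So M_i is free over A / m^(i+1) on Z, and a point of the limit is
a function from Z to A, the limit of its coefficients, which has finite support
modulo every power of m: a decaying function ([Fdec_limit_iso]).

Finally, let K be a submodule of A^n with generators c_1, ..., c_k. A decaying
function with values in K is a combination of the c_l with decaying coefficients
([decaying_coefficients]): this needs that elements of K that are very divisible
in A^n are also divisible in K, the weak form of the Artin-Rees lemma proved in
[weak_Artin_Rees]. For K the module of relations of a_1, ..., a_n, it gives that
relations between decaying functions are trivial, so that F_dec(Z, A) is flat;
for K = m^i in A^1, it gives that m^i F_dec(Z, A) consists of the functions with
values in m^i, so that completeness can be checked pointwise. *)

(** * Submodules spanned by a set *)

Section Span.
Variables (R : comNzRingType) (V : lmodType R).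
Implicit Types (S : {pred V}) (X : set V).

Lemma lspan_elim (P : V -> Prop) X :
    P 0 -> (forall a u v, P u -> P v -> P (a *: u + v)) ->
    (forall x, X x -> P x) ->
  forall v, v \in lspan X -> P v.
Proof.
move=> P0 PD PX v /lspanP[s sX ->]; elim: s sX => [|p s IHs] sX.
  by rewrite big_nil.
rewrite big_cons; apply: PD.
  by apply/PX/sX; rewrite mem_head.
by apply: IHs => q qs; apply: sX; rewrite inE qs orbT.
Qed.

Lemma submodD S : submod_closed S -> {in S &, forall u v, u + v \in S}.
Proof. by case=> _ Slin u v Su Sv; rewrite -[u]scale1r Slin. Qed.

Lemma submodZ S a : submod_closed S -> {in S, forall u, a *: u \in S}.
Proof. by case=> S0 Slin u Su; rewrite -[_ *: _]addr0 Slin. Qed.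

Lemma submodB S : submod_closed S -> {in S &, forall u v, u - v \in S}.
Proof. by move=> Ssub u v Su Sv; rewrite addrC -scaleN1r; apply: Ssub.2. Qed.

Lemma submod_sum S (I : Type) (r : seq I) (P : pred I) (F : I -> V) :
    submod_closed S -> (forall i, P i -> F i \in S) ->
  \sum_(i <- r | P i) F i \in S.
Proof.
move=> Ssub SF; apply: (big_ind (fun x => x \in S)) => //; first exact: Ssub.1.
by move=> u v; exact: submodD.
Qed.

Lemma lspan_subset X S :
  submod_closed S -> (forall x, X x -> x \in S) -> {subset lspan X <= S}.
Proof.
by case=> S0 Slin XS v; apply: (@lspan_elim (fun v => v \in S)) => // *; exact: Slin.
Qed.

Lemma lspan_seqP (s : seq V) v :
  reflect (exists c : 'I_(size s) -> R, v = \sum_i c i *: tnth (in_tuple s) i)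
          (v \in lspan [set x | x \in s]%classic).
Proof.
apply: (iffP idP) => [|[c ->]]; last first.
  apply: submod_sum => [|i _]; first exact: lspan_submod_closed.
  apply: submodZ; first exact: lspan_submod_closed.
  by apply: lspan_gen; rewrite /= mem_tnth.
pose lin w := exists c : 'I_(size s) -> R, w = \sum_i c i *: tnth (in_tuple s) i.
apply: (@lspan_elim lin).
- by exists (fun=> 0); rewrite big1 // => i _; rewrite scale0r.
- move=> a u w [c ->] [d ->]; exists (fun i => a * c i + d i).
  rewrite scaler_sumr -big_split; apply: eq_bigr => i _.
  by rewrite scalerDl scalerA.
move=> x /= xs; have /tnthP[j ->] : x \in in_tuple s by [].
exists (fun i => (i == j)%:R); rewrite (bigD1 j) //= eqxx scale1r big1 ?addr0 //.
by move=> i /negbTE ->; rewrite scale0r.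
Qed.

End Span.

(** * Relations between elements of a module *)

Section Relations.
Variables (R : comNzRingType).

(** The parameter I is there for modules over R / I, which are handled as
R-modules; I = 0 gives the equational criterion of flatness. *)
Definition trivial_relations (I : {pred R}) (M : lmodType R) : Prop :=
  forall n (a : 'I_n -> R) (x : 'I_n -> M), \sum_i a i *: x i = 0 ->
  exists k (b : 'M[R]_(n, k)) (y : 'I_k -> M),
    (forall i, x i = \sum_j b i j *: y j) /\
    (forall j, \sum_i a i * b i j \in I).

Definition row_comb (M : lmodType R) n (r : 'rV[R]_n) (x : 'I_n -> M) : M :=
  \sum_i r 0 i *: x i.

Lemma row_comb_mul (M : lmodType R) n k (r : 'rV[R]_n) (b : 'M_(n, k)) (y : 'I_k -> M) :
  row_comb (r *m b) y = \sum_i r 0 i *: (\sum_j b i j *: y j).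
Proof.
rewrite /row_comb; under [RHS]eq_bigr do rewrite scaler_sumr.
rewrite exchange_big; apply: eq_bigr => j _; rewrite mxE scaler_suml.
by apply: eq_bigr => i _; rewrite scalerA.
Qed.

Lemma row_comb_delta (M : lmodType R) n (x : 'I_n -> M) i :
  row_comb (delta_mx 0 i) x = x i.
Proof.
rewrite /row_comb (bigD1 i) //= mxE !eqxx scale1r big1 ?addr0 // => j /negbTE ji.
by rewrite mxE ji andbF scale0r.
Qed.

Lemma row_combP (M : lmodType R) n (x : 'I_n -> M) : linear (fun r => row_comb r x).
Proof.
move=> a r s; rewrite /row_comb scaler_sumr -big_split; apply: eq_bigr => i _.
by rewrite !mxE scalerDl scalerA.
Qed.

(** The relations are made trivial one after the other: once x = b y with b
trivializing the first relations, the next one becomes a relation between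
the y_j. *)
Lemma trivial_system (M : lmodType R) : trivial_relations (pred1 0) M ->
  forall n (rs : seq 'rV[R]_n) (x : 'I_n -> M),
    (forall r, r \in rs -> row_comb r x = 0) ->
  exists k (b : 'M[R]_(n, k)) (y : 'I_k -> M),
    (forall i, x i = row_comb (row i b) y) /\
    (forall r, r \in rs -> r *m b = 0).
Proof.
move=> trivM n; elim=> [|r rs IHrs] x rx0.
  exists n, 1%:M, x; split=> // i.
  by rewrite row1 row_comb_delta.
have [|k [b [y [xE rs0]]]] := IHrs x.
  by move=> r' r'rs; apply: rx0; rewrite inE r'rs orbT.
have rb0 : row_comb (r *m b) y = 0.
  rewrite row_comb_mul -[RHS](rx0 r (mem_head _ _)); apply: eq_bigr => i _.
  by rewrite xE; congr (_ *: _); apply: eq_bigr => j _; rewrite mxE.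
have [l [c [z [yE rbc0]]]] := trivM _ _ _ rb0.
exists l, (b *m c), z; split=> [i|r'].
  rewrite row_mul row_comb_mul xE; apply: eq_bigr => j _.
  by rewrite yE.
rewrite inE mulmxA => /predU1P[->|/rs0->]; last by rewrite mul0mx.
by apply/rowP=> j; rewrite !mxE; apply/eqP/rbc0.
Qed.

(** Finitely many elements of M and finitely many linear identities between elements
of M lift to a free module R^k along y : R^k -> M. A flat module thus looks free
as far as finitely many computations can see; the map g is linear only where this
is asked for. *)
Lemma local_section (M : lmodType R) (ys : seq M) (rels : seq (R * (M * M))) :
    trivial_relations (pred1 0) M ->
  exists k (g : M -> 'rV[R]_k) (y : 'I_k -> M),
    (forall w, w \in ys -> w = row_comb (g w) y) /\
    (forall r, r \in rels -> g (r.1 *: r.2.1 + r.2.2) = r.1 *: g r.2.1 + g r.2.2).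
Proof.
move=> trivM.
pose terms (r : R * (M * M)) := [:: r.2.1; r.2.2; r.1 *: r.2.1 + r.2.2].
(* All elements in sight; the relations between them are the rows in rs. *)
pose zs := ys ++ flatten [seq terms r | r <- rels].
pose n := size zs; pose x (i : 'I_n) : M := tnth (in_tuple zs) i.
pose e w : 'rV[R]_n := \row_i ((i : nat) == index w zs)%:R.
have eE w : w \in zs -> row_comb (e w) x = w.
  move=> wzs; have lt_w : (index w zs < n)%N by rewrite index_mem.
  rewrite -[RHS](nth_index 0 wzs) -[RHS](tnth_nth _ (in_tuple zs) (Ordinal lt_w)).
  rewrite -/(x _) -[RHS]row_comb_delta; congr row_comb.
  by apply/rowP=> j; rewrite !mxE eqxx.
have rels_zs r w : r \in rels -> w \in terms r -> w \in zs.
  move=> rr wr; rewrite mem_cat; apply/orP; right; apply/flatten_mapP.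
  by exists r.
pose rs := [seq e (r.1 *: r.2.1 + r.2.2) - (r.1 *: e r.2.1 + e r.2.2) | r <- rels].
have [|k [b [y [xE rs0]]]] := @trivial_system M trivM n rs x.
  move=> _ /mapP[r rr ->]; set u := e _; set v := r.1 *: _ + _.
  have -> : u - v = -1 *: v + u by rewrite scaleN1r addrC.
  rewrite row_combP row_combP !eE ?scaleN1r ?addNr //;
    by apply: (rels_zs r) => //; rewrite !inE eqxx ?orbT.
exists k, (fun w => e w *m b), y; split=> [w wys|r rr].
  rewrite row_comb_mul -[LHS]eE ?mem_cat ?wys //; apply: eq_bigr => i _.
  by rewrite xE; congr (_ *: _); apply: eq_bigr => j _; rewrite mxE.
have /rs0 : e (r.1 *: r.2.1 + r.2.2) - (r.1 *: e r.2.1 + e r.2.2) \in rs.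
  by apply/mapP; exists r.
by rewrite mulmxBl mulmxDl -scalemxAl => /eqP; rewrite subr_eq0 => /eqP.
Qed.

Lemma trivial_relations_seq (I : {pred R}) (M : lmodType R) n (a : 'I_n -> R)
    (x : 'I_n -> M) (s : seq ('rV[R]_n * M)) :
    (forall i, x i = \sum_(p <- s) p.1 0 i *: p.2) ->
    (forall p, p \in s -> \sum_i a i * p.1 0 i \in I) ->
  exists k (b : 'M[R]_(n, k)) (y : 'I_k -> M),
    (forall i, x i = \sum_j b i j *: y j) /\
    (forall j, \sum_i a i * b i j \in I).
Proof.
move=> xE sI; exists (size s), (\matrix_(i, j) (tnth (in_tuple s) j).1 0 i).
exists (fun j => (tnth (in_tuple s) j).2); split=> [i|j].
  by rewrite xE big_tnth; apply: eq_bigr => j _; rewrite mxE.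
by under eq_bigr do rewrite mxE; apply: sI; exact: mem_tnth.
Qed.

End Relations.

(** * Flatness and trivial relations *)

Section Tensor.
Variables (R : comNzRingType) (V W : lmodType R).

HB.instance Definition _ (v : V) := GRing.isLinear.Build R W (tensor V W) _
  (@pure_tensor R V W v) ((pure_tensor_bilinear V W).2 v).

Definition pure_tensor_at (w : W) (v : V) : tensor V W := pure_tensor v w.

HB.instance Definition _ (w : W) := GRing.isLinear.Build R V (tensor V W) _
  (pure_tensor_at w) ((pure_tensor_bilinear V W).1 w).

Lemma pure_tensorZl (a : R) (v : V) (w : W) : pure_tensor (a *: v) w = a *: pure_tensor v w.
Proof. exact: (GRing.scalable_linear ((pure_tensor_bilinear V W).1 w)). Qed.

Lemma tensor_sumP (t : tensor V W) :
  exists s : seq (V * W), t = \sum_(p <- s) pure_tensor p.1 p.2.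
Proof.
have [D ->] := lproj_surj t; rewrite -[D]freeg_sumE linear_sum.
exists [seq (coeff p D *: p.1, p.2) | p <- dom D].
rewrite [RHS]big_map; apply: eq_bigr => -[v w] _ /=.
by rewrite pure_tensorZl freeg_monomial linearZ.
Qed.

Lemma lproj_sum_gen (s : seq (V * W)) :
  lproj (lspan (@tensor_rel R V W)) (\sum_(p <- s) << p >>) =
  \sum_(p <- s) pure_tensor p.1 p.2.
Proof.
elim: s => [|[v w] s IHs]; first by rewrite !big_nil raddf0.
rewrite !big_cons raddfD; congr (_ + _); exact: IHs.
Qed.

(** A tensor vanishes because of finitely many defining relations. Those on the left
factor hold in V for every value of g; hence a g that respects the finitely many
identities involved on the right factor can be applied to the tensor, as if it
were linear. *)
Lemma tensor_vanish (s : seq (V * W)) :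
    \sum_(p <- s) pure_tensor p.1 p.2 = 0 ->
  exists rels : seq (R * (W * W)), forall g : W -> R,
    (forall r, r \in rels -> g (r.1 *: r.2.1 + r.2.2) = r.1 * g r.2.1 + g r.2.2) ->
  \sum_(p <- s) g p.2 *: p.1 = 0.
Proof.
pose F (g : W -> R) : {linear {freeg (V * W) / R} -> V} := fglift (fun p => g p.2 *: p.1).
have FU g p : F g << p >> = g p.2 *: p.1 by rewrite /F /= liftU scale1r.
move=> s0; pose D : {freeg (V * W) / R} := \sum_(p <- s) << p >>.
have : D \in lspan (@tensor_rel R V W).
  rewrite -[D]subr0; apply/lproj_eq; rewrite raddf0; apply: etrans s0.
  exact: lproj_sum_gen.
pose killed E := exists rels : seq (R * (W * W)), forall g : W -> R,
    (forall r, r \in rels -> g (r.1 *: r.2.1 + r.2.2) = r.1 * g r.2.1 + g r.2.2) ->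
  F g E = 0.
suff H E : E \in lspan (@tensor_rel R V W) -> killed E.
  move/H => -[rels relsP]; exists rels => g /relsP.
  move=> FD0; rewrite -[RHS]FD0 linear_sum; apply: eq_bigr => p _; symmetry; exact: FU.
apply: (@lspan_elim _ _ killed).
- by exists [::] => g _; rewrite linear0.
- move=> a u v [r1 r1P] [r2 r2P]; exists (r1 ++ r2) => g gP.
  rewrite linearP r1P ?r2P ?scaler0 ?addr0 // => r rr; apply: gP;
    by rewrite mem_cat rr ?orbT.
move=> t [[a [v [v' [w ->]]]]|[a [v [w [w' ->]]]]].
  exists [::] => g _; rewrite !linearB linearZ /= !FU /=.
  by rewrite scalerDr !scalerA mulrC -addrA -opprD subrr.
exists [:: (a, (w, w'))] => g /(_ _ (mem_head _ _)) /= gE.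
by rewrite !linearB linearZ /= !FU /= gE scalerDl scalerA -addrA -opprD subrr.
Qed.

End Tensor.

Arguments pure_tensor_at {R} V {W} w v.

Section FlatTrivial.
Variables (R : comNzRingType) (M : lmodType R).

(** A tensor of N and M killed by f is killed for finitely many reasons, which
already hold after M is replaced by a free module R^k; there the tensor is a
k-tuple of elements of N, and f is injective. *)
Lemma trivial_relations_flat : trivial_relations (pred1 0) M -> flat M.
Proof.
move=> trivM N N' f f_inj.
suff ker0 t : tensor_map M f t = 0 -> t = 0.
  move=> t u tu; apply/eqP; rewrite -subr_eq0; apply/eqP/ker0.
  by rewrite raddfB /= tu subrr.
have [s ->] := tensor_sumP t => ft0.
have {}ft0 : \sum_(p <- [seq (f p.1, p.2) | p <- s]) pure_tensor p.1 p.2 = 0.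
  rewrite big_map -[RHS]ft0 raddf_sum; apply: eq_bigr => p _.
  by rewrite /= tensor_mapE.
have [rels relsP] := tensor_vanish ft0.
have [k [g [y [gE grels]]]] := local_section [seq p.2 | p <- s] rels trivM.
have coord0 j : \sum_(p <- s) g p.2 0 j *: p.1 = 0.
  apply: f_inj; rewrite raddf0 -[RHS](relsP (fun w => g w 0 j)).
    by rewrite big_map raddf_sum; apply: eq_bigr => p _ /=; rewrite linearZ.
  by move=> r /grels ->; rewrite !mxE.
transitivity (\sum_(p <- s) \sum_j pure_tensor (g p.2 0 j *: p.1) (y j)).
  rewrite big_seq [RHS]big_seq; apply: eq_bigr => p ps.
  rewrite {1}[p.2]gE ?map_f // linear_sum; apply: eq_bigr => j _.
  by rewrite linearZ pure_tensorZl.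
rewrite exchange_big big1 // => j _.
by rewrite -[RHS](raddf0 (pure_tensor_at N (y j))) -(coord0 j) raddf_sum.
Qed.

Section Kernel.
Variables (n : nat) (a : 'I_n -> R).

Definition relation_mod : {pred 'rV[R]_n} := fun v => \sum_i a i * v 0 i == 0.

Lemma relation_mod_submod : submod_closed relation_mod.
Proof.
split=> [|c u v /eqP u0 /eqP v0].
  by apply/eqP; rewrite big1 // => i _; rewrite mxE mulr0.
rewrite unfold_in; apply/eqP; transitivity (c * \sum_i a i * u 0 i + \sum_i a i * v 0 i).
  rewrite mulr_sumr -big_split; apply: eq_bigr => i _.
  by rewrite !mxE mulrDr mulrCA.
by rewrite u0 v0 mulr0 addr0.
Qed.

HB.instance Definition _ :=
  GRing.isSubmodClosed.Build R 'rV[R]_n relation_mod relation_mod_submod.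

Definition relation_form (v : 'rV[R]_n) : R^o := \sum_i a i * v 0 i.

Lemma relation_form_linear : linear relation_form.
Proof.
move=> c u v; rewrite /relation_form scaler_sumr -big_split.
by apply: eq_bigr => i _; rewrite !mxE mulrDr [c *: _]mulrCA.
Qed.

HB.instance Definition _ := GRing.isLinear.Build R 'rV[R]_n R^o _
  relation_form relation_form_linear.

Lemma relation_form0 v : v \in relation_mod -> relation_form v = 0.
Proof. by move/eqP. Qed.

Definition relation_quot_form : lquot relation_mod -> R^o := lquot_lift relation_form.

HB.instance Definition _ := GRing.isLinear.Build R (lquot relation_mod) R^o _
  relation_quot_form (lquot_lift_linear relation_form0).

Lemma relation_quot_form_inj : injective relation_quot_form.
Proof.
move=> x y; have [u ->] := lproj_surj x; have [v ->] := lproj_surj y.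
rewrite /relation_quot_form !(lquot_liftE relation_form0) => uv.
apply/lproj_eq; rewrite unfold_in -/(relation_form (u - v)).
by rewrite raddfB /= uv subrr.
Qed.

(** The submodule K M of M^n, where K is the relation module: that x lies in K M says
precisely that the relation between its entries is trivial. *)
Definition relation_scale : {pred {ffun 'I_n -> M}} :=
  lspan [set F | exists v y, v \in relation_mod /\ F = [ffun i => v 0 i *: y]]%classic.

HB.instance Definition _ := GRing.SubmodClosed.on relation_scale.

Definition relation_pair (v : lquot relation_mod) (y : M) : lquot relation_scale :=
  lproj relation_scale [ffun i => repr v 0 i *: y].

Lemma relation_pairE v y :
  relation_pair (lproj relation_mod v) y = lproj relation_scale [ffun i => v 0 i *: y].
Proof.
apply/lproj_eq/lspan_gen; exists (repr (lproj relation_mod v) - v), y.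
split; first exact: repr_lproj.
by apply/ffunP=> i; rewrite !ffunE !mxE scalerBl.
Qed.

Lemma relation_pair_bilinear : bilinear_map relation_pair.
Proof.
split=> [y c v w|v c y z].
  have [{}v ->] := lproj_surj v; have [{}w ->] := lproj_surj w.
  rewrite -linearP !relation_pairE -linearP; congr lproj; apply/ffunP=> i.
  by rewrite !ffunE !mxE scalerDl scalerA.
have [{}v ->] := lproj_surj v.
rewrite !relation_pairE -linearP; congr lproj; apply/ffunP=> i.
by rewrite !ffunE scalerDr !scalerA mulrC.
Qed.

End Kernel.

Arguments relation_quot_form {n} a _.
Arguments relation_scale {n} a _.
Arguments relation_pair_bilinear {n} a.

(** The form a embeds R^n / K into R, so that the sum of the e_i (x) x_i, whose image
in R (x) M is 1 (x) (a_1 x_1 + ... + a_n x_n) = 0, vanishes in (R^n / K) (x) M.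
Its image in M^n / K M is the class of x. *)
Lemma flat_trivial_relations : flat M -> trivial_relations (pred1 0) M.
Proof.
move=> flatM n a x ax0; pose K := relation_mod a.
pose e i : 'rV[R]_n := delta_mx 0 i.
have e_in i j : e i 0 j = (j == i)%:R by rewrite mxE eqxx.
have t0 : \sum_i pure_tensor (lproj K (e i)) (x i) = 0 :> tensor (lquot K) M.
  apply: (flatM _ _ (relation_quot_form a) (@relation_quot_form_inj n a)).
  rewrite raddf0 raddf_sum -[RHS](raddf0 (pure_tensor (1 : R^o))) -ax0 raddf_sum.
  apply: eq_bigr => i _ /=; rewrite tensor_mapE.
  have formE : relation_quot_form a (lproj K (e i)) = a i *: (1 : R^o).
    rewrite /relation_quot_form (lquot_liftE (@relation_form0 n a)) /= /relation_form.
    rewrite (bigD1 i) //= e_in eqxx mulr1 big1 ?addr0 => [|j /negbTE ji].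
      by rewrite [RHS]mulr1.
    by rewrite e_in ji mulr0.
  transitivity (pure_tensor (a i *: (1 : R^o)) (x i)); first by congr pure_tensor.
  by rewrite pure_tensorZl linearZ.
have {t0} : [ffun i => x i] \in relation_scale a.
  rewrite -[X in X \in _]subr0; apply/lproj_eq; rewrite raddf0.
  rewrite -[RHS](raddf0 (tensor_lift (relation_pair_bilinear a))) -t0 raddf_sum.
  transitivity (\sum_i lproj (relation_scale a) [ffun j => (e i) 0 j *: x i]).
    rewrite -raddf_sum; congr lproj; apply/ffunP=> j; rewrite sum_ffunE ffunE.
    rewrite (bigD1 j) //= ffunE e_in eqxx scale1r big1 ?addr0 // => i /negbTE ij.
    by rewrite ffunE e_in eq_sym ij scale0r.
  apply: eq_bigr => i _; symmetry.
  rewrite -[LHS]/(tensor_lift _ (pure_tensor _ _)) tensor_liftE; exact: relation_pairE.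
pose good (F : {ffun 'I_n -> M}) := exists s : seq ('rV[R]_n * M),
  (forall i, F i = \sum_(p <- s) p.1 0 i *: p.2) /\
  (forall p, p \in s -> \sum_i a i * p.1 0 i \in pred1 (0 : R)).
suff H : forall F, F \in relation_scale a -> good F.
  move=> /H[s [sE s0]]; apply: (trivial_relations_seq (s := s)) => // i.
  by rewrite -sE ffunE.
apply: (@lspan_elim _ _ good).
- by exists [::]; split=> // i; rewrite big_nil ffunE.
- move=> c F G [s [sE s0]] [t [tE t0]]; exists ([seq (p.1, c *: p.2) | p <- s] ++ t).
  split=> [i|p].
    rewrite big_cat big_map !ffunE sE tE scaler_sumr; congr (_ + _).
    by apply: eq_bigr => p _; rewrite !scalerA mulrC.
  by rewrite mem_cat => /orP[/mapP[q /s0 q0 ->]|/t0].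
move=> F [v [y [vK ->]]]; exists [:: (v, y)]; split=> [i|p].
  by rewrite big_seq1 ffunE.
by rewrite inE => /eqP->.
Qed.

End FlatTrivial.

Section FlatQuotient.
Variables (A : comNzRingType) (I : idealr A) (M : lmodType A) (IM0 : annihilates I M).

Lemma quot_pi_eq0 a : (\pi_({ideal_quot I}) a == 0) = (a \in I).
Proof. by rewrite -[a in RHS]subr0 Quotient.idealrBE -(rmorph0 \pi_({ideal_quot I})). Qed.

Lemma quot_pi_comb n (a b : 'I_n -> A) :
  (\sum_i \pi_({ideal_quot I}) (a i) * \pi_({ideal_quot I}) (b i) == 0) =
  (\sum_i a i * b i \in I).
Proof.
rewrite -quot_pi_eq0 rmorph_sum; congr (_ == _).
by apply: eq_bigr => i _; rewrite rmorphM.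
Qed.

Lemma flat_quotP : flat (quot_module IM0) <-> trivial_relations I M.
Proof.
split=> [/flat_trivial_relations trivM|trivM].
  move=> n a x ax0; have [|k [b [y [xE ab0]]]] := trivM n (fun i => \pi_({ideal_quot I}) (a i)) x.
    by rewrite -[RHS]ax0; apply: eq_bigr => i _; exact: quot_module_scaleE.
  exists k, (\matrix_(i, j) repr (b i j)), y; split=> [i|j].
    by rewrite xE; apply: eq_bigr => j _; rewrite mxE.
  rewrite -quot_pi_comb; apply: etrans (ab0 j); congr (_ == _).
  by apply: eq_bigr => i _; rewrite mxE reprK.
apply: trivial_relations_flat => n a x ax0.
have [//|k [b [y [xE ab0]]]] := trivM n (fun i => repr (a i)) x.
exists k, (map_mx \pi_({ideal_quot I}) b), y; split=> [i|j].
  rewrite xE; apply: eq_bigr => j _; rewrite mxE; symmetry; exact: quot_module_scaleE.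
have := ab0 j; rewrite -quot_pi_comb => /eqP ab0'; apply/eqP; apply: etrans ab0'.
by apply: eq_bigr => i _; rewrite mxE reprK.
Qed.

End FlatQuotient.

(** * Weak Artin-Rees lemma *)

Definition fg_submodules (R : comNzRingType) (V : lmodType R) : Prop :=
  forall S : {pred V}, submod_closed S ->
    exists s : seq V, S =i lspan [set v | v \in s]%classic.

Section Noetherian.
Variables (A : comNzRingType) (A_noetherian : noetherian A) (V : lmodType A).

(** With x the first generator, the coefficients on x of the elements of S form an
ideal; lifts of its generators to S generate S up to elements of the span of the
other generators, where induction applies. *)
Lemma fg_sub_lspan (s : seq V) (S : {pred V}) :
    submod_closed S -> {subset S <= lspan [set v | v \in s]%classic} ->
  exists t : seq V, S =i lspan [set v | v \in t]%classic.
Proof.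
elim: s S => [|x s IHs] S Ssub sS.
  exists [::] => v; apply/idP/idP => [/sS//|].
  by apply: lspan_subset.
pose W : {pred V} := lspan [set v | v \in s]%classic.
have Wsub : submod_closed W := lspan_submod_closed _.
pose I : {pred A^o} := fun a => `[< exists u, u \in S /\ u - (a : A) *: x \in W >].
have Isub : submod_closed I.
  split; first by apply/asboolP; exists 0; rewrite scale0r subr0 Ssub.1 Wsub.1.
  move=> c a b /asboolP[u [Su Wu]] /asboolP[v [Sv Wv]]; apply/asboolP.
  exists (c *: u + v); split; first exact: Ssub.2.
  have -> : c *: u + v - (c * a + b : A) *: x = c *: (u - a *: x) + (v - b *: x).
    by rewrite scalerBr scalerA scalerDl opprD addrACA.
  exact: Wsub.2.
have [t It] := A_noetherian Isub.
have /choice[g gP] c : exists u, c \in I -> u \in S /\ u - (c : A) *: x \in W.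
  have [/asboolP[u uP]|nI] := boolP (c \in I); first by exists u.
  by exists 0.
have tI c : c \in t -> c \in I by move=> ct; rewrite It; apply: lspan_gen.
have [|v /andP[_ Wv]//|t' St'] := IHs (fun v => (v \in S) && (v \in W)).
  split=> [|a u v /andP[Su Wu] /andP[Sv Wv]]; apply/andP; first by rewrite Ssub.1 Wsub.1.
  by rewrite Ssub.2 ?Wsub.2.
have gs_sub := lspan_submod_closed [set v | v \in [seq g c | c <- t] ++ t']%classic.
exists ([seq g c | c <- t] ++ t') => v; apply/idP/idP => [Sv|]; last first.
  apply: lspan_subset => // {}v; rewrite /= mem_cat => /orP[/mapP[c ct ->]|t'v].
    by case: (gP _ (tI _ ct)).
  have : v \in lspan [set w | w \in t']%classic by apply: lspan_gen.
  by rewrite -St' => /andP[].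
have [a Wa] : exists a, v - a *: x \in W.
  move/sS: Sv; apply: (@lspan_elim _ _ (fun v => exists a, v - a *: x \in W)).
  - by exists 0; rewrite scale0r subr0 Wsub.1.
  - move=> c {}v w [a Wv] [b Ww]; exists (c * a + b).
    have -> : c *: v + w - (c * a + b) *: x = c *: (v - a *: x) + (w - b *: x).
      by rewrite scalerBr scalerA scalerDl opprD addrACA.
    exact: Wsub.2.
  move=> {}v /=; rewrite inE => /predU1P[->|sv].
    by exists 1; rewrite scale1r subrr Wsub.1.
  by exists 0; rewrite scale0r subr0; apply: lspan_gen.
have : a \in I by apply/asboolP; exists v.
pose G : {pred V} := lspan [set v | v \in [seq g c | c <- t] ++ t']%classic.
rewrite It => /(@lspan_elim _ _ (fun a : A^o => exists w, [/\ w \in G, w \in S & w - a *: x \in W])).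
case.
- by exists 0; rewrite scale0r subr0 Wsub.1 gs_sub.1 Ssub.1.
- move=> c b b' [w [Gw Sw Ww]] [w' [Gw' Sw' Ww']]; exists (c *: w + w'); split.
  + exact: gs_sub.2.
  + exact: Ssub.2.
  have -> : c *: w + w' - (c * b + b' : A) *: x = c *: (w - b *: x) + (w' - b' *: x).
    by rewrite scalerBr scalerA scalerDl opprD addrACA.
  exact: Wsub.2.
- move=> c /= ct; have [Sg Wg] := gP _ (tI _ ct); exists (g c); split=> //.
  by apply: lspan_gen; rewrite /= mem_cat map_f.
move=> w [Gw Sw Ww]; rewrite -[v](subrK w); apply: submodD => //.
apply: (@lspan_subset _ _ [set w | w \in t']%classic) => //.
  by move=> u t'u; apply: lspan_gen; rewrite /= mem_cat t'u orbT.
rewrite -St'; apply/andP; split; first exact: submodB.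
have -> : v - w = (v - a *: x) - (w - a *: x) by rewrite opprB addrA subrK.
exact: submodB.
Qed.

Lemma fg_submodules_gen (s : seq V) :
  (forall v, v \in lspan [set v | v \in s]%classic) -> fg_submodules V.
Proof. by move=> sV S Ssub; apply: (@fg_sub_lspan s). Qed.

End Noetherian.

Lemma fg_submodules_row (A : comNzRingType) n : noetherian A -> fg_submodules 'rV[A]_n.
Proof.
move=> A_noeth; apply: (@fg_submodules_gen _ A_noeth _ [seq delta_mx 0 j | j : 'I_n]).
move=> v; rewrite [v]row_sum_delta.
have sub := lspan_submod_closed [set v | v \in [seq delta_mx 0 j | j : 'I_n]]%classic.
apply: submod_sum => // j _; apply: submodZ => //; apply: lspan_gen.
by rewrite /= map_f ?mem_enum.
Qed.

Section Powers.
Variables (A : comNzRingType) (I : {pred A}).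

Lemma idpowZ i a x : x \in idpow I i -> a * x \in idpow I i.
Proof. exact: (submodZ _ (idpow_submod I i)). Qed.

Lemma idpowD i x y : x \in idpow I i -> y \in idpow I i -> x + y \in idpow I i.
Proof. exact: (submodD (idpow_submod I i)). Qed.

Lemma idpowB i x y : x \in idpow I i -> y \in idpow I i -> x - y \in idpow I i.
Proof. exact: (submodB (idpow_submod I i)). Qed.

Lemma idpowM i j x y : x \in idpow I i -> y \in idpow I j -> x * y \in idpow I (i + j).
Proof.
move=> xi yj; elim: i x xi => [|i IHi] x; first by move=> _; exact: idpowZ.
have [S0 Slin] := idpow_submod I (i.+1 + j).
apply: (@lspan_elim _ A^o (fun x : A^o => (x : A) * y \in idpow I (i.+1 + j))).
- by rewrite mul0r.
- by move=> a u v uy vy; rewrite -[a *: u]/(a * u) mulrDl -mulrA; apply: Slin.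
move=> _ [c [u [Ic iu ->]]]; apply: lspan_gen; exists c, (u * y).
by split; [|exact: IHi|exact: esym (mulrA _ _ _)].
Qed.

Lemma idpowX i a : a \in I -> a ^+ i \in idpow I i.
Proof.
move=> Ia; elim: i => [|i IHi] //; rewrite exprS; apply: lspan_gen.
by exists a, (a ^+ i).
Qed.

Lemma idpowD_elim i j (P : A -> Prop) :
    P 0 -> (forall a u v, P u -> P v -> P (a * u + v)) ->
    (forall x y, x \in idpow I i -> y \in idpow I j -> P (x * y)) ->
  forall z, z \in idpow I (i + j) -> P z.
Proof.
elim: i P => [|i IHi] P P0 PD PM z; first by move=> jz; rewrite -[z]mul1r; apply: PM.
apply: (@lspan_elim _ A^o P) => // _ [c [x [Ic ijx ->]]].
apply: (IHi (fun x => P (c * x))) ijx.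
- by rewrite mulr0.
- by move=> a u v; rewrite mulrDr mulrCA; exact: PD.
move=> {z}x y ix jy; rewrite mulrA; apply: PM => //.
by apply: lspan_gen; exists c, x.
Qed.

End Powers.

Section WeakArtinRees.
Variables (A : comNzRingType) (m : idealr A) (V : lmodType A).
Implicit Types (J L : {pred V}).

(** Zorn's lemma for submodules L with J <= L and L meet K <= J. The chains
range over sets X with X union J in place of L, so that the empty chain
needs no separate treatment. *)
Lemma maximal_submod_meet (K : {pred V}) J : submod_closed J ->
  exists L, [/\ submod_closed L, {subset J <= L},
    forall x, x \in L -> x \in K -> x \in J
    & forall Y : {pred V}, submod_closed Y -> {subset L <= Y} ->
        (forall x, x \in Y -> x \in K -> x \in J) -> {subset Y <= L}].
Proof.
move=> Jsub; pose Q (Y : set V) :=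
  (forall a x y, Y x -> Y y -> Y (a *: x + y)) /\ (forall x, Y x -> x \in K -> x \in J).
pose ext (X : set V) : set V := fun x => X x \/ x \in J.
have [X [[Xlin XK] Xmax]] : exists X : set V, Q (ext X) /\
    forall Y : set V, (X `<` Y)%classic -> ~ Q (ext Y).
  apply: (@Zorn_bigcup _ (fun X => Q (ext X))) => F FQ Ftot; split; last first.
    by move=> x [[X FX Xx]|//]; apply: (FQ X FX).2; left.
  move=> a x y [[X FX Xx]|Jx] [[Y FY Yy]|Jy].
  - have [XY|YX] := Ftot X Y FX FY.
      have [|Z|J'] := (FQ Y FY).1 a x y _ (or_introl Yy); [by left; exact: XY| |by right].
      by left; exists Y.
    have [|Z|J'] := (FQ X FX).1 a x y (or_introl Xx); [by left; exact: YX| |by right].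
    by left; exists X.
  - have [Z|J'] := (FQ X FX).1 a x y (or_introl Xx) (or_intror Jy); last by right.
    by left; exists X.
  - have [Z|J'] := (FQ Y FY).1 a x y (or_intror Jx) (or_introl Yy); last by right.
    by left; exists Y.
  by right; apply: Jsub.2.
exists (fun x => `[< ext X x >]); split.
- split; first by apply/asboolP; right; exact: Jsub.1.
  by move=> a x y /asboolP Lx /asboolP Ly; apply/asboolP; exact: Xlin.
- by move=> x Jx; apply/asboolP; right.
- by move=> x /asboolP; exact: XK.
move=> Y Ysub LY YK y Yy; apply: contrapT => nLy.
have extY x : ext (fun v => v \in Y) x -> x \in Y.
  by move=> [//|Jx]; apply: LY; apply/asboolP; right.
apply: (Xmax (fun v => v \in Y)).
  split=> [x Xx|YX]; first by apply: LY; apply/asboolP; left.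
  by apply: nLy; apply/asboolP; left; exact: YX.
split=> [a u v /extY Yu /extY Yv|x /extY]; last exact: YK.
by left; apply: Ysub.2.
Qed.

Definition add_image L (a : A) : {pred V} :=
  fun w => `[< exists l v, l \in L /\ w = l + a *: v >].

Lemma add_image_submod L a : submod_closed L -> submod_closed (add_image L a).
Proof.
move=> Lsub; split.
  by apply/asboolP; exists 0, 0; rewrite scaler0 addr0 Lsub.1.
move=> c x y /asboolP[l [v [Ll ->]]] /asboolP[k [w [Lk ->]]]; apply/asboolP.
exists (c *: l + k), (c *: v + w); split; first exact: Lsub.2.
by rewrite !scalerDr addrACA !scalerA mulrC.
Qed.

Lemma sub_add_image L a : {subset L <= add_image L a}.
Proof. by move=> l Ll; apply/asboolP; exists l, 0; rewrite scaler0 addr0. Qed.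

Lemma image_add_image L a v : submod_closed L -> a *: v \in add_image L a.
Proof. by move=> Lsub; apply/asboolP; exists 0, v; rewrite add0r Lsub.1. Qed.

(** From m^K V <= L + a V one gets m^(K j) V <= L + a^j V for all j. *)
Lemma nil_generators_step (K : nat) a L : submod_closed L ->
    (exists k, forall v, a ^+ k *: v \in L) ->
    (forall u v, u \in idpow m K -> u *: v \in add_image L a) ->
  exists k, forall u v, u \in idpow m k -> u *: v \in L.
Proof.
move=> Lsub [k ak] Ka; exists (K * k)%N.
suff H j u v : u \in idpow m (K * j) -> u *: v \in add_image L (a ^+ j).
  move=> u v /(H _ u v)/asboolP[l [w [Ll ->]]].
  by apply: submodD => //; exact: ak.
elim: j u v => [|j IHj] u v.
  by move=> _; rewrite expr0 -[u *: v]scale1r image_add_image.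
have [Q0 Qlin] := add_image_submod (a ^+ j.+1) Lsub.
rewrite mulnS; apply: (@idpowD_elim _ _ _ _ (fun u => u *: v \in add_image L (a ^+ j.+1))).
- by rewrite scale0r.
- by move=> c x y xQ yQ; rewrite scalerDl -scalerA; exact: Qlin.
move=> x y xK yK; rewrite -scalerA.
have /asboolP[l [w [Ll ->]]] := IHj _ v yK.
have /asboolP[l' [w' [Ll' xw]]] := Ka _ w xK.
rewrite scalerDr scalerA mulrC -scalerA xw scalerDr scalerA -exprSr addrA.
apply: submodD; [by [] | | exact: image_add_image].
by apply/sub_add_image/submodD => //; exact: submodZ.
Qed.

(** An ideal whose generators are nilpotent on V / L is itself nilpotent there. The
generators are added to L one at a time; the last hypothesis says that m^K V is
contained in L + s V, in the form: in every submodule Q containing L and s V. *)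
Lemma nil_generators_pow (s : seq A) L : submod_closed L ->
    (forall a, a \in s -> exists k, forall v, a ^+ k *: v \in L) ->
    (exists K, forall Q : {pred V}, submod_closed Q -> {subset L <= Q} ->
      (forall a v, a \in s -> a *: v \in Q) ->
      forall u v, u \in idpow m K -> u *: v \in Q) ->
  exists k, forall u v, u \in idpow m k -> u *: v \in L.
Proof.
elim: s L => [|a s IHs] L Lsub sL [K KP]; first by exists K; exact: KP.
have [| | |k kP] := IHs (add_image L a).
- exact: add_image_submod.
- move=> b bs; have [|k kP] := sL b; first by rewrite inE bs orbT.
  by exists k => v; apply/sub_add_image/kP.
- exists K => Q Qsub LQ sQ; apply: KP => // [v /(sub_add_image a)/LQ//|b v].
  by rewrite inE => /predU1P[->|/sQ//]; apply/LQ/image_add_image.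
by apply: (nil_generators_step Lsub _ kP); apply: sL; exact: mem_head.
Qed.

Hypotheses (A_noetherian : noetherian A) (V_noetherian : fg_submodules V).

(** With J = m^n K, let L be maximal among the submodules containing J and meeting K
inside J. It suffices that every a in m is nilpotent on V / L, for then m^k V
is contained in L for some k. Choose j such that the submodules (L : a^i) do not
grow from i = j on. If l + a^j w lies in K, then a^n (l + a^j w) lies in J, hence
a^(n+j) w in L, hence a^j w in L: so L + a^j V still meets K inside J, and
equals L by maximality. *)
Lemma weak_Artin_Rees (K : {pred V}) n : submod_closed K ->
  exists k, forall v, v \in K -> v \in pow_submod m k -> v \in idscale (idpow m n) K.
Proof.
move=> Ksub; have Jsub := lspan_submod_closed
  [set v | exists a x, [/\ a \in idpow m n, x \in K & v = a *: x]]%classic.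
have [L [Lsub JL LK Lmax]] := maximal_submod_meet K Jsub.
have nil a : a \in m -> exists k, forall v, a ^+ k *: v \in L.
  move=> ma; pose U : {pred V} := fun v => `[< exists i, a ^+ i *: v \in L >].
  have upL i j v : (i <= j)%N -> a ^+ i *: v \in L -> a ^+ j *: v \in L.
    by move=> /subnK <- iv; rewrite exprD -scalerA; exact: submodZ.
  have Usub : submod_closed U.
    split; first by apply/asboolP; exists 0; rewrite scaler0 Lsub.1.
    move=> c u v /asboolP[i iu] /asboolP[j jv]; apply/asboolP; exists (maxn i j).
    rewrite scalerDr scalerA mulrC -scalerA; apply: Lsub.2.
      by apply: upL iu; exact: leq_maxl.
    by apply: upL jv; exact: leq_maxr.
  have [s sU] := V_noetherian Usub.
  have [j jP] : exists j, forall v, v \in s -> a ^+ j *: v \in L.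
    have : forall v, v \in s -> v \in U by move=> v vs; rewrite sU; exact: lspan_gen.
    elim: {sU} s => [|v s IHs] vsU; first by exists 0.
    have [|j jP] := IHs; first by move=> w ws; apply: vsU; rewrite inE ws orbT.
    have /asboolP[i iv] := vsU v (mem_head _ _).
    exists (maxn i j) => w; rewrite inE => /predU1P[->|/jP jw].
      by apply: upL iv; exact: leq_maxl.
    by apply: upL jw; exact: leq_maxr.
  have stable i v : a ^+ i *: v \in L -> a ^+ j *: v \in L.
    move=> iv; have : v \in U by apply/asboolP; exists i.
    rewrite sU; apply: (@lspan_elim _ _ (fun v => a ^+ j *: v \in L)) => //.
      by rewrite scaler0 Lsub.1.
    by move=> c u w uL wL; rewrite scalerDr scalerA mulrC -scalerA; exact: Lsub.2.
  exists j => v; apply: (Lmax (add_image L (a ^+ j))).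
  - exact: add_image_submod.
  - exact: sub_add_image.
  - move=> _ /asboolP[l [w [Ll ->]]] lwK; apply: (LK) => //.
    apply: submodD => //; apply: (stable (n + j)%N).
    have -> : a ^+ (n + j) *: w = a ^+ n *: (l + a ^+ j *: w) - a ^+ n *: l.
      by rewrite scalerDr addrAC subrr add0r scalerA exprD.
    apply: submodB => //; last exact: submodZ.
    apply: JL; apply: lspan_gen; exists (a ^+ n), (l + a ^+ j *: w).
    by split=> //; exact: idpowX.
  exact: image_add_image.
have msub : submod_closed (m : {pred A^o}).
  split; first exact: (@rpred0 _ m).
  by move=> a u v mu mv; apply: (@rpredD _ m) => //; exact: (@idealMr _ m).
have [s ms] := A_noetherian msub.
have [| |k kP] := @nil_generators_pow s L Lsub.
- by move=> a sa; apply: nil; rewrite ms; apply: lspan_gen.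
- exists 1%N => Q Qsub LQ sQ u v /idpow1_sub; rewrite ms.
  apply: (@lspan_elim _ A^o (fun u : A^o => (u : A) *: v \in Q)) => {u}.
  + by rewrite scale0r Qsub.1.
  + by move=> c x y xQ yQ; rewrite scalerDl -scalerA; exact: Qsub.2.
  + by move=> x /= xs; exact: sQ.
exists k => v vK vk; apply: LK => //; move: vk; apply: lspan_subset => //.
by move=> _ [a [x [ka _ ->]]]; exact: kP.
Qed.

End WeakArtinRees.

Lemma inj_surj_bijective (T U : Type) (f : T -> U) :
  injective f -> (forall y, exists x, f x = y) -> bijective f.
Proof.
move=> f_inj /choice[g gK]; exists g => // x; exact: f_inj.
Qed.

Lemma lmod_iso_inv (R : comNzRingType) (M N : lmodType R) : lmod_iso M N ->
  exists (f : {linear M -> N}) (g : {linear N -> M}), cancel f g /\ cancel g f.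
Proof.
move=> [f [g fK gK]]; exists f, (HB.pack g
  (GRing.isLinear.Build R N M _ g (can2_linear fK gK)) : {linear N -> M}).
by split.
Qed.

(** * Elementwise form of completeness *)

Section Completeness.
Variables (A : comNzRingType) (m : idealr A).

Lemma pow_submod_closed (N : lmodType A) i : submod_closed (pow_submod m i : {pred N}).
Proof. exact: lspan_submod_closed. Qed.

Lemma pow_submod_ring i : (pow_submod m i : {pred A^o}) =i idpow m i.
Proof.
move=> z; apply/idP/idP => [|zi].
  apply: lspan_subset; first exact: idpow_submod.
  by move=> _ [a [x [ai _ ->]]]; rewrite [a *: x]mulrC; exact: idpowZ.
by apply: lspan_gen; exists z, 1; split=> //; rewrite [RHS]mulr1.
Qed.

Lemma linear_pow_submod (M N : lmodType A) (f : {linear M -> N}) i x :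
  x \in pow_submod m i -> f x \in pow_submod m i.
Proof.
have [P0 Plin] := pow_submod_closed N i.
apply: (@lspan_elim _ _ (fun x => f x \in pow_submod m i)).
- by rewrite raddf0.
- by move=> a u v fu fv; rewrite linearP; exact: Plin.
move=> _ [a [y [ai _ ->]]]; rewrite linearZ; apply: lspan_gen.
by exists a, (f y).
Qed.

Lemma adic_quot_mapE (N : lmodType A) i (x : N) :
  adic_quot_map m N i (lproj (pow_submod m i.+2) x) = lproj (pow_submod m i.+1) x.
Proof. by apply/lproj_eq/pow_submodS_sub/repr_lproj. Qed.

Lemma adically_completeP (N : lmodType A) :
  adically_complete m N <->
  (forall x : N, (forall i, x \in pow_submod m i.+1) -> x = 0) /\
  (forall u : nat -> N, (forall i, u i.+1 - u i \in pow_submod m i.+1) ->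
     exists x, forall i, x - u i \in pow_submod m i.+1).
Proof.
split=> [/[dup] /bij_inj canon_inj [g _ gK]|[sep cauchy]].
  split=> [x x0|u uC].
    apply: canon_inj; apply: val_inj; apply: functional_extensionality_dep => i /=.
    by apply/lproj_eq; rewrite subr0; exact: x0.
  have yC : (fun i => lproj (pow_submod m i.+1) (u i) : adic_quot m N i) \in
      compatible (adic_quot_map m N).
    apply/asboolP => i; rewrite adic_quot_mapE; apply/lproj_eq; exact: uC.
  exists (g (InvLim yC)) => i; apply/lproj_eq.
  have := congr1 (fun y : invlim (adic_quot_map m N) => \val y i) (gK (InvLim yC)).
  exact.
apply: inj_surj_bijective => [x y xy|y].
  apply/eqP; rewrite -subr_eq0; apply/eqP/sep => i; apply/lproj_eq.
  exact: (congr1 (fun y : invlim (adic_quot_map m N) => \val y i) xy).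
have /asboolP yC := valP y.
have [|x xP] := cauchy (fun i => repr (\val y i)).
  move=> i; apply/lproj_eq; rewrite -(adic_quot_mapE i) lproj_repr.
  by rewrite -[LHS]/(adic_quot_map m N i _) lproj_repr yC.
exists x; apply: val_inj; apply: functional_extensionality_dep => i /=.
by rewrite -[RHS]lproj_repr; apply/lproj_eq/xP.
Qed.

Lemma lmod_iso_complete (M N : lmodType A) :
  lmod_iso M N -> adically_complete m N -> adically_complete m M.
Proof.
move=> /lmod_iso_inv[f [g [fK gK]]] /adically_completeP[sep cauchy].
apply/adically_completeP; split=> [x x0|u uC].
  apply: (can_inj fK); rewrite raddf0; apply: sep => i; exact: linear_pow_submod.
have [|y yP] := cauchy (fun i => f (u i)).
  by move=> i; rewrite -raddfB; exact: linear_pow_submod.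
exists (g y) => i; rewrite -[u i]fK -raddfB; exact: linear_pow_submod.
Qed.

Lemma lmod_iso_trivial_relations (I : {pred A}) (M N : lmodType A) :
  lmod_iso M N -> trivial_relations I N -> trivial_relations I M.
Proof.
move=> /lmod_iso_inv[f [g [fK gK]]] trivN n a x ax0.
have [|k [b [y [xE ab0]]]] := trivN n a (fun i => f (x i)).
  by rewrite -[RHS](raddf0 f) -ax0 raddf_sum; apply: eq_bigr => i _; rewrite /= linearZ.
exists k, b, (fun j => g (y j)); split=> // i.
rewrite -[x i]fK xE raddf_sum; apply: eq_bigr => j _.
by rewrite /= linearZ.
Qed.

End Completeness.

(** * Decaying functions *)

Section Decaying.
Variables (A : comNzRingType) (m : idealr A) (Z : Type).

Lemma decayingP (f : Z -> A) :
  f \in decaying m (Z:=Z) <-> forall k, finite_set [set z | f z \notin idpow m k]%classic.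
Proof.
split=> [/asboolP fd [|k]|fd].
- by apply: sub_finite_set (finite_set0 Z) => z /=.
- by apply: sub_finite_set (fd k) => z /= /ord_leP.
apply/asboolP => k; apply: sub_finite_set (fd k.+1) => z /= /ord_leP.
exact.
Qed.

Lemma Fdec_combE n (a : 'I_n -> A) (F : 'I_n -> Fdec m Z) z :
  (\sum_i a i *: F i) z = \sum_i a i * F i z.
Proof.
exact: (big_morph (fun F : Fdec m Z => F z : A) (id1 := 0) (op1 := +%R)).
Qed.

Hypotheses (A_noetherian : noetherian A)
  (A_sep : forall x : A, (forall i, x \in idpow m i.+1) -> x = 0).

Lemma row_pow_submod n (v : 'rV[A]_n) k :
  (forall j, v 0 j \in idpow m k) -> v \in pow_submod m k.
Proof.
move=> vk; rewrite [v]row_sum_delta.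
have sub := pow_submod_closed m 'rV[A]_n k.
by apply: submod_sum => // j _; apply: lspan_gen; exists (v 0 j), (delta_mx 0 j).
Qed.

Lemma idscale_lspan (V : lmodType A) (s : seq V) k v :
    v \in idscale (idpow m k) (lspan [set x | x \in s]%classic) ->
  exists2 c : 'I_(size s) -> A, forall l, c l \in idpow m k
    & v = \sum_l c l *: tnth (in_tuple s) l.
Proof.
have [P0 Plin] := idpow_submod m k.
apply: (@lspan_elim _ _ (fun v => exists2 c : 'I_(size s) -> A,
  forall l, c l \in idpow m k & v = \sum_l c l *: tnth (in_tuple s) l)).
- by exists (fun=> 0) => //; rewrite big1 // => l _; rewrite scale0r.
- move=> a {}v w [c ck ->] [d dk ->]; exists (fun l => a * c l + d l).
    by move=> l; apply: Plin.
  rewrite scaler_sumr -big_split; apply: eq_bigr => l _.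
  by rewrite scalerDl scalerA.
move=> _ [a [x [ak /lspan_seqP[c ->] ->]]]; exists (fun l => a * c l).
  by move=> l; rewrite mulrC; exact: idpowZ.
by rewrite scaler_sumr; apply: eq_bigr => l _; rewrite scalerA.
Qed.

(** At every z, the coefficients are chosen in m^i for the largest i for which the
weak Artin-Rees lemma allows it; they decay since i tends to infinity with
the order of the values y_j(z). *)
Lemma decaying_coefficients n (y : 'I_n -> Fdec m Z) (s : seq 'rV[A]_n) :
    (forall z, \row_j (y j z : A) \in lspan [set v | v \in s]%classic) ->
  exists w : 'I_(size s) -> Fdec m Z, forall j,
    y j = \sum_l tnth (in_tuple s) l 0 j *: w l.
Proof.
pose K : {pred 'rV[A]_n} := lspan [set v | v \in s]%classic.
pose v z : 'rV[A]_n := \row_j (y j z : A); move=> vK.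
have Ksub : submod_closed K := lspan_submod_closed _.
have /choice[k kP] i := weak_Artin_Rees m A_noetherian (@fg_submodules_row _ n A_noetherian) i Ksub.
(* Taking N i >= i bounds the exponents available at a nonzero value. *)
pose N i := maxn (k i) i.
have NP i z : (forall j, (y j z : A) \in idpow m (N i)) ->
    exists2 c : 'I_(size s) -> A, forall l, c l \in idpow m i
    & v z = \sum_l c l *: tnth (in_tuple s) l.
  move=> yN; apply: idscale_lspan; apply: kP; first exact: vK.
  apply: row_pow_submod => j; rewrite mxE.
  exact: (@idpow_sub _ m _ _ (leq_maxl (k i) i)).
have coef z : exists c : 'I_(size s) -> A, v z = \sum_l c l *: tnth (in_tuple s) l /\
    forall i, (forall j, (y j z : A) \in idpow m (N i)) -> forall l, c l \in idpow m i.
  have [y0|/existsNP[j0 yj0]] := pselect (forall j, (y j z : A) = 0).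
    exists (fun=> 0); split.
      by rewrite big1 => [|l _]; [apply/rowP => j; rewrite !mxE y0|rewrite scale0r].
    by move=> i _ l; have [] := idpow_submod m i.
  have [i0 yi0] : exists i0, (y j0 z : A) \notin idpow m i0.
    apply: contrapT => /forallNP yi; apply: yj0; apply: A_sep => i.
    by apply: contrapT => /negP; exact: yi.
  pose T i := `[< forall j, (y j z : A) \in idpow m (N i) >].
  have Tub i : T i -> (i <= i0)%N.
    move=> /asboolP/(_ j0) yNi; rewrite leqNgt; apply: contra yi0 => lt_i0i.
    by apply: idpow_sub yNi; rewrite (leq_trans (ltnW lt_i0i)) ?leq_maxr.
  have [exT|noT] := pselect (exists i, T i).
    have [i /asboolP/NP[c ck vE] imax] := ex_maxnP exT Tub.
    exists c; split=> // i' /asboolP/imax le_i'i l; exact: idpow_sub (ck l).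
  have /lspan_seqP[c vE] := vK z.
  exists c; split=> // i /asboolP Ti; case: noT; by exists i.
have [c cP] := choice coef.
have wd l : (fun z => c z l : A^o) \in decaying m (Z:=Z).
  apply/decayingP => i; apply: (@sub_finite_set _ _
    (\bigcup_(j in [set: 'I_n]) [set z | (y j z : A) \notin idpow m (N i)])%classic).
    move=> z /= cz; apply: contrapT => yz; case/negP: cz; apply: (cP z).2 => j.
    by apply: contrapT => /negP yN; apply: yz; exists j.
  by apply: bigcup_finite => // j _; exact: (@decayingP (y j)).1 (valP (y j)) _.
exists (fun l => DecayingFun (wd l)) => j; apply: val_inj; apply: funext => z.
rewrite [RHS]Fdec_combE; have /rowP/(_ j) := (cP z).1; rewrite mxE => yE.
apply: etrans yE _.
rewrite summxE; apply: eq_bigr => l _; by rewrite mxE mulrC.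
Qed.

Lemma Fdec_trivial_relations : trivial_relations (pred1 0) (Fdec m Z).
Proof.
move=> n a x ax0.
have [s Ks] := @fg_submodules_row _ n A_noetherian _ (relation_mod_submod a).
have [z|w wP] := @decaying_coefficients n x s.
  rewrite -Ks unfold_in; under eq_bigr do rewrite mxE.
  by rewrite -(Fdec_combE a x) ax0.
exists (size s), (\matrix_(i, j) tnth (in_tuple s) j 0 i), w; split=> [i|j].
  by rewrite wP; apply: eq_bigr => j _; rewrite mxE.
under eq_bigr do rewrite mxE.
have : tnth (in_tuple s) j \in relation_mod a.
  by rewrite Ks; apply: lspan_gen; exact: mem_tnth.
by [].
Qed.

(** The inclusion from right to left needs finitely many generators of m^i: those of
the submodule m^i of A^1. *)
Lemma Fdec_pow_submod (F : Fdec m Z) i :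
  F \in pow_submod m i <-> forall z, (F z : A) \in idpow m i.
Proof.
have [P0 Plin] := idpow_submod m i.
split=> [Fi z|Fi].
  move: F Fi; apply: (@lspan_elim _ _ (fun F : Fdec m Z => (F z : A) \in idpow m i)) => //.
    by move=> a u v; exact: Plin.
  by move=> _ [a [x [ai _ ->]]]; rewrite -[(_ *: x) z]/(a * x z) mulrC idpowZ.
pose K : {pred 'rV[A]_1} := fun v => v 0 0 \in idpow m i.
have Ksub : submod_closed K.
  split=> [|a u v uK vK]; first by rewrite unfold_in mxE.
  by rewrite unfold_in !mxE; exact: Plin.
have [s Ks] := @fg_submodules_row _ 1 A_noetherian _ Ksub.
have [z|w wP] := @decaying_coefficients 1 (fun=> F) s.
  by rewrite -Ks unfold_in mxE.
have sub := pow_submod_closed m (Fdec m Z) i.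
rewrite (wP 0); apply: submod_sum => // l _; apply: lspan_gen.
exists (tnth (in_tuple s) l 0 0), (w l); split=> //.
have : tnth (in_tuple s) l \in K by rewrite Ks; apply: lspan_gen; exact: mem_tnth.
by [].
Qed.

Lemma Fdec_complete : adically_complete m A^o -> adically_complete m (Fdec m Z).
Proof.
move=> /adically_completeP[sep cauchy]; apply/adically_completeP; split=> [F F0|u uC].
  apply: val_inj; apply: funext => z; apply: A_sep => i.
  exact: (Fdec_pow_submod F i.+1).1.
have lim z : exists x : A, forall i, x - u i z \in idpow m i.+1.
  have [i|x xP] := cauchy (fun i => u i z : A^o).
    by rewrite pow_submod_ring; exact: (Fdec_pow_submod _ i.+1).1 (uC i) z.
  by exists x => i; rewrite -pow_submod_ring.
have [f fP] := choice lim.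
have fd : (f : Z -> A^o) \in decaying m (Z:=Z).
  apply/decayingP => k; have /decayingP/(_ k.+1) := valP (u k).
  apply: sub_finite_set => z /= fz; apply: contra fz => ukz.
  apply: (@idpow_sub _ m k.+1) => //; rewrite -[f z](subrK (u k z)).
  exact: (submodD (idpow_submod m k.+1)).
by exists (DecayingFun fd) => i; apply/Fdec_pow_submod => z; exact: fP.
Qed.

End Decaying.

(** * Base change between quotients of the ring *)

Section QuotientBaseChange.
Variables (A : comNzRingType) (I J : idealr A) (IJ : {subset I <= J}).
Variables (M N : lmodType A) (IM0 : annihilates I M) (JN0 : annihilates J N).
Variable f : {linear M -> N}.

Let rho := quot_ring_map IJ.
Let B := restr rho {ideal_quot J}^o.
Let MI := quot_module IM0.

Lemma pure_tensor_pi (a : A) (x : M) :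
  pure_tensor (1 : B) (a *: x : MI) = pure_tensor (\pi_({ideal_quot J}) a : B) (x : MI).
Proof.
transitivity (pure_tensor (1 : B) (\pi_({ideal_quot I}) a *: (x : MI))).
  by congr pure_tensor; symmetry; exact: (@quot_module_scaleE A I M IM0 a x).
rewrite linearZ; apply: etrans (esym (pure_tensorZl _ _ _)) _; congr pure_tensor.
rewrite -[LHS]/(rho _ * 1) mulr1; exact: quot_ring_mapE.
Qed.

Let tens (x : M) : tensor B MI := pure_tensor (1 : B) (x : MI).

Lemma tensD x y : tens (x + y) = tens x + tens y.
Proof. exact: (raddfD (pure_tensor (1 : B))). Qed.

Lemma tens0 : tens 0 = 0.
Proof. exact: (raddf0 (pure_tensor (1 : B))). Qed.

(** The ring map A / I -> A / J is surjective, so that scalars move to the right. *)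
Lemma tensor_quot_pure (t : tensor B MI) : exists x : M, t = tens x.
Proof.
have [s ->] := tensor_sumP t; elim: s => [|[b x] s [y IHs]].
  by exists 0; rewrite big_nil tens0.
exists ((repr (b : {ideal_quot J}) *: (x : M)) + y); rewrite big_cons IHs tensD.
by congr (_ + _); rewrite [RHS]pure_tensor_pi reprK.
Qed.

Lemma tens_ideal (x : M) : x \in idscale J predT -> tens x = 0.
Proof.
move=> /lspanP[s sJ ->]; elim: s sJ => [|p s IHs] sJ; first by rewrite big_nil tens0.
rewrite big_cons tensD IHs ?addr0 => [|q qs]; last by apply: sJ; rewrite inE qs orbT.
have [a [y [Ja _ ->]]] := sJ _ (mem_head _ _).
rewrite scalerA [LHS]pure_tensor_pi.
have -> : \pi_({ideal_quot J}) (p.1 * a) = 0.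
  by apply/eqP; rewrite quot_pi_eq0 idealMr.
exact: (raddf0 (pure_tensor_at B (y : MI))).
Qed.

Lemma ideal_lquot_annihilated : annihilates I (lquot (idscale J (predT : {pred M}))).
Proof.
move=> a x Ia; have [v ->] := lproj_surj x.
by rewrite -linearZ IM0 ?raddf0.
Qed.

Let W := quot_module ideal_lquot_annihilated.

Lemma lproj_piZ a (x : M) :
  lproj (idscale J (predT : {pred M})) (a *: x) =
  \pi_({ideal_quot I}) a *: (lproj (idscale J (predT : {pred M})) x : W).
Proof.
rewrite [LHS]lproj_is_scalable; symmetry.
exact: (@quot_module_scaleE A I _ ideal_lquot_annihilated a _).
Qed.

(** The map A / J x M -> M / J M that inverts M / J M -> A / J (x) M. *)
Definition ideal_pair (b : B) (x : MI) : W :=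
  lproj (idscale J (predT : {pred M})) (repr (b : {ideal_quot J}) *: (x : M)).

Lemma ideal_pairE a (x : M) :
  ideal_pair (\pi_({ideal_quot J}) a : B) x =
  lproj (idscale J (predT : {pred M})) (a *: (x : M)).
Proof.
apply/lproj_eq/lspan_gen; exists (repr (\pi_({ideal_quot J}) a) - a), x.
by rewrite Quotient.idealrBE reprK scalerBl.
Qed.

Lemma ideal_pair_bilinear : bilinear_map ideal_pair.
Proof.
split=> [x c b b'|b c x x'].
  rewrite -[c](@reprK _ {ideal_quot I}) -[b](@reprK _ {ideal_quot J}).
  rewrite -[b'](@reprK _ {ideal_quot J}).
  set c0 := repr c; set b0 := repr _; set b0' := repr _.
  have -> : \pi_({ideal_quot I}) c0 *: (\pi_({ideal_quot J}) b0 : B) + \pi_({ideal_quot J}) b0'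
      = \pi_({ideal_quot J}) (c0 * b0 + b0') :> B.
    rewrite rmorphD rmorphM; congr (_ * _ + _ : {ideal_quot J}); exact: quot_ring_mapE.
  rewrite !ideal_pairE scalerDl raddfD; congr (_ + _).
  by rewrite -scalerA [LHS]lproj_piZ.
rewrite -[c](@reprK _ {ideal_quot I}); set c0 := repr c.
rewrite -[b](@reprK _ {ideal_quot J}); set b0 := repr _.
rewrite !ideal_pairE -[RHS]/(_ + lproj _ _) [_ *: x](@quot_module_scaleE A I M IM0).
rewrite scalerDr raddfD; congr (_ + _).
by rewrite scalerA mulrC -scalerA [LHS]lproj_piZ.
Qed.

(** Since A / J (x) M is M / J M, the induced map is bijective when f induces a
bijection from M / J M to N; the inclusion of J M in the kernel of f is
automatic, as J kills N. *)
Lemma quot_base_changeP :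
  bijective (base_change_map (quot_module_map IJ IM0 JN0 f :
    {linear quot_module IM0 -> restr (quot_ring_map IJ) (quot_module JN0)})) <->
  (forall y, exists x, f x = y) /\ (forall x, f x = 0 -> x \in idscale J predT).
Proof.
set G := base_change_map _.
have GE x : G (tens x) = f x by rewrite [LHS]base_change_mapE scale1r.
split=> [Gbij|[f_surj f_ker]].
  have G_inj := bij_inj Gbij; case: Gbij => g _ gK; split=> [y|x fx0].
    by have [x xE] := tensor_quot_pure (g y); exists x; rewrite -GE -xE gK.
  have tx : tens x = tens 0 by apply: G_inj; rewrite !GE fx0 raddf0.
  rewrite -[x]subr0; apply/lproj_eq.
  have liftE y : tensor_lift ideal_pair_bilinear (tens y) = lproj (idscale J predT) y.
    rewrite [LHS]tensor_liftE -[1 : B]/(1 : {ideal_quot J}) -(rmorph1 \pi_({ideal_quot J})).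
    by rewrite ideal_pairE scale1r.
  by rewrite -!liftE tx.
apply: inj_surj_bijective => [t u|y]; last first.
  by have [x <-] := f_surj y; exists (tens x).
have [x ->] := tensor_quot_pure t; have [y ->] := tensor_quot_pure u.
rewrite !GE => fxy; have /tens_ideal txy : x - y \in idscale J predT.
  by apply: f_ker; rewrite raddfB /= fxy subrr.
by rewrite -[x](subrK y) tensD txy add0r.
Qed.

End QuotientBaseChange.

(** * The system of truncations of a module *)

Section Truncation.
Variables (A : comNzRingType) (m : idealr A) (M : lmodType A).

Lemma adic_quot_annihilated i : annihilates (idpowS m i) (adic_quot m M i).
Proof.
move=> a x ma; have [v ->] := lproj_surj x; rewrite -lproj_is_scalable.
rewrite -(raddf0 (lproj (pow_submod m i.+1))); apply/lproj_eq; rewrite subr0.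
by apply: lspan_gen; exists a, v.
Qed.

Lemma adic_quot_base_change i :
  bijective (sys_induced (adic_quot_map m M) adic_quot_annihilated i).
Proof.
apply/quot_base_changeP; split=> [y|x].
  by have [v ->] := lproj_surj y; exists (lproj _ v); exact: adic_quot_mapE.
have [v ->] := lproj_surj x => fv0.
have /lspanP[s sm ->] : v \in pow_submod m i.+1.
  rewrite -[v]subr0; apply/lproj_eq; rewrite raddf0 -[RHS]fv0; symmetry.
  exact: adic_quot_mapE.
rewrite raddf_sum /= big_seq; apply: submod_sum => [|p ps]; first exact: lspan_submod_closed.
have [a [y [ma _ ->]]] := sm p ps; rewrite scalerA lproj_is_scalable.
apply: lspan_gen; exists (p.1 * a), (lproj _ y); split=> //; exact: idpowZ.
Qed.

Definition adic_truncations : adic_system m := AdicSystem adic_quot_base_change.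

(** A relation with coefficients a in M / m^(i+1) M lifts to an equality in M of the
form a v = g_1 w_1 + ... + g_q w_q with g_k in m^(i+1). Trivializing this relation
with n + q terms by b, the first n rows of b trivialize the original relation
modulo m^(i+1). *)
Lemma adic_quot_trivial_relations i : trivial_relations (pred1 0) M ->
  trivial_relations (idpowS m i) (adic_quot m M i).
Proof.
move=> trivM n a x ax0; pose v j := repr (x j).
have /lspanP[s sm vE] : \sum_j a j *: v j \in pow_submod m i.+1.
  rewrite -[\sum_j _]subr0; apply/lproj_eq; rewrite raddf0 -[RHS]ax0 raddf_sum.
  by apply: eq_bigr => j _; rewrite [LHS]lproj_is_scalable lproj_repr.
pose t (k : 'I_(size s)) := tnth (in_tuple s) k.
have /choice[g gP] k : exists g : A * M, g.1 \in idpow m i.+1 /\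
    (t k).1 *: (t k).2 = g.1 *: g.2.
  have [b [y [mb _ ->]]] := sm (t k) (mem_tnth k (in_tuple s)).
  by exists ((t k).1 * b, y); rewrite scalerA; split=> //; exact: idpowZ.
pose c (j : 'I_(n + size s)) := match fintype.split j with inl j => a j | inr k => - (g k).1 end.
pose z (j : 'I_(n + size s)) := match fintype.split j with inl j => v j | inr k => (g k).2 end.
have cl j : c (lshift (size s) j) = a j by rewrite /c -[lshift (size s) j]/(unsplit (inl j)) unsplitK.
have cr k : c (rshift n k) = - (g k).1.
  by rewrite /c -[rshift n k]/(unsplit (inr k)) unsplitK.
have zl j : z (lshift (size s) j) = v j by rewrite /z -[lshift (size s) j]/(unsplit (inl j)) unsplitK.
have zr k : z (rshift n k) = (g k).2.
  by rewrite /z -[rshift n k]/(unsplit (inr k)) unsplitK.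
have [|k [b [y [zE cb0]]]] := trivM (n + size s)%N c z.
  rewrite big_split_ord /=; under eq_bigr do rewrite cl zl.
  apply/eqP; rewrite vE [\sum_(p <- s) _]big_tnth addr_eq0 -sumrN; apply/eqP; apply: eq_bigr => k _.
  by rewrite cr zr scaleNr opprK; exact: (gP k).2.
exists k, (\matrix_(j, l) b (lshift (size s) j) l), (fun l => lproj _ (y l)); split=> [j|l].
  rewrite -[x j]lproj_repr -/(v j) -zl zE raddf_sum; apply: eq_bigr => l _.
  by rewrite mxE; exact: lproj_is_scalable.
under eq_bigr do rewrite mxE.
have := cb0 l; rewrite inE big_split_ord /= addr_eq0; under eq_bigr do rewrite cl.
move=> /eqP ->; rewrite -sumrN.
apply: (submod_sum _ (idpow_submod m i.+1)) => r _.
by rewrite cr mulNr opprK mulrC; exact: (idpowZ _ (gP r).1).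
Qed.

End Truncation.

(** * A basis of the residue space *)

Section FreegCombination.
Variables (A : comNzRingType) (Z : choiceType) (V : lmodType A) (e : Z -> V).

Definition freeg_comb (D : {freeg Z / A}) : V := fglift e D.

Lemma freeg_comb_linear : linear freeg_comb.
Proof.
move=> a D E; pose F : {linear {freeg Z / A} -> V} := fglift e.
exact: (linearP F).
Qed.

HB.instance Definition _ :=
  GRing.isLinear.Build A {freeg Z / A} V _ freeg_comb freeg_comb_linear.

Lemma freeg_combE D : freeg_comb D = \sum_(z <- dom D) coeff z D *: e z.
Proof.
rewrite -[D in LHS]freeg_sumE raddf_sum; apply: eq_bigr => z _.
exact: liftU.
Qed.

Lemma freeg_combU z : freeg_comb << z >> = e z.
Proof. by rewrite /freeg_comb liftU scale1r. Qed.

End FreegCombination.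

Lemma freeg_comb_morph (A : comNzRingType) (Z : choiceType) (V W : lmodType A)
    (f : {linear V -> W}) (e : Z -> V) (e' : Z -> W) D :
  (forall z, f (e z) = e' z) -> f (freeg_comb e D) = freeg_comb e' D.
Proof.
move=> fe; rewrite !freeg_combE raddf_sum; apply: eq_bigr => z _.
by rewrite /= linearZ fe.
Qed.

Section ResidueBasis.
Variables (A : comNzRingType) (m : idealr A) (m_max : maximal_ideal m).

Lemma idpow1 : idpow m 1 =i m.
Proof.
move=> a; apply/idP/idP => [/idpow1_sub//|ma].
by apply: lspan_gen; exists a, 1; split=> //; rewrite [RHS]mulr1.
Qed.

Lemma maximal_ideal_inverse a : a \notin m -> exists b, 1 - b * a \in m.
Proof.
move=> nma; pose J : {pred A} := fun x => `[< exists c, x - c * a \in m >].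
have [J1|J1] := boolP (1 \in J); first by move/asboolP: J1.
have Jcl : idealr_closed J.
  split=> //; first by apply/asboolP; exists 0; rewrite mul0r subr0 rpred0.
  move=> c x y /asboolP[b mx] /asboolP[d my]; apply/asboolP; exists (c * b + d).
  have -> : c * x + y - (c * b + d) * a = c * (x - b * a) + (y - d * a).
    by rewrite mulrBr mulrA mulrDl opprD addrACA.
  by rewrite rpredD // idealMr.
pose J' : idealr A := HB.pack J (isIdealr.Build A J Jcl).
have mJ : {subset m <= J'}.
  by move=> x mx; apply/asboolP; exists 0; rewrite mul0r subr0.
case/negP: nma; rewrite -(m_max mJ); apply/asboolP.
by exists 1; rewrite mul1r subrr rpred0.
Qed.

Variables (V : lmodType A) (mV0 : annihilates m V).

(** Linear independence over the field A / m, with coefficients in A. *)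
Definition residue_free (X : set V) : Prop :=
  forall (s : seq V) (a : V -> A), uniq s -> (forall v, v \in s -> X v) ->
  \sum_(v <- s) a v *: v = 0 -> forall v, v \in s -> a v \in m.

Lemma maximal_residue_free : exists X, residue_free X /\
  forall Y, (X `<` Y)%classic -> ~ residue_free Y.
Proof.
apply: Zorn_bigcup => F Ffree Ftot s a uniq_s sF sum0 v vs.
have [X FX sX] : exists2 X, F X & forall w, w \in s -> X w.
  have [X0 FX0 _] := sF v vs; elim: s {uniq_s sum0 vs} sF => [|w s IHs] sF.
    by exists X0.
  have [|X FX sX] := IHs; first by move=> u us; apply: sF; rewrite inE us orbT.
  have [Y FY Yw] := sF w (mem_head _ _).
  have [XY|YX] := Ftot X Y FX FY.
    by exists Y => // u; rewrite inE => /predU1P[->//|/sX/XY].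
  by exists X => // u; rewrite inE => /predU1P[->|/sX//]; exact: YX.
exact: (Ffree X FX s a).
Qed.

Lemma residue_basis : exists (Z : choiceType) (e : Z -> V),
  (forall v, exists D, v = freeg_comb e D) /\
  (forall D, freeg_comb e D = 0 -> forall z, coeff z D \in m).
Proof.
have [X [Xfree Xmax]] := maximal_residue_free.
pose e (z : X) : V := val z; exists X, e; split=> [v|D D0 z]; last first.
  have [zD|zD] := boolP (z \in dom D); last by rewrite (coeff_outdom zD) rpred0.
  pose a (v : V) := oapp (fun z : X => coeff z D) 0 (insub v).
  have aE y : a (val y) = coeff y D by rewrite /a valK.
  rewrite -aE; apply: (Xfree [seq val y | y <- dom D]); last exact: map_f.
  - by rewrite map_inj_uniq ?uniq_dom //; exact: val_inj.
  - by move=> _ /mapP[y _ ->]; exact: set_valP.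
  by rewrite big_map -[RHS]D0 freeg_combE; apply: eq_bigr => y _; rewrite aE.
pose span v := exists D, v = freeg_comb e D.
have span_lin a u w : span u -> span w -> span (a *: u + w).
  by move=> [D ->] [E ->]; exists (a *: D + E); rewrite linearP.
have span0 : span 0 by exists 0; rewrite raddf0.
have spanX w : X w -> span w.
  by move=> /mem_set Xw; exists << SigSub Xw >>; rewrite freeg_combU.
apply: contrapT => nspan.
apply: (Xmax (fun w => X w \/ w = v)).
  split=> [w|XvX]; first by left.
  by apply: nspan; apply/spanX/XvX; right.
move=> s a uniq_s sXv sum0.
have rest_span (r : seq V) : (forall w, w \in r -> X w) -> span (\sum_(w <- r) a w *: w).
  elim: r => [|w r IHr] rX; first by rewrite big_nil.
  rewrite big_cons; apply: span_lin; first exact/spanX/rX/mem_head.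
  by apply: IHr => u ur; apply: rX; rewrite inE ur orbT.
have [vs|nvs] := boolP (v \in s); last first.
  apply: Xfree => // w ws; case: (sXv w ws) => // wv.
  by rewrite wv (negbTE nvs) in ws.
have remX w : w \in rem v s -> X w.
  by rewrite mem_rem_uniq // => /andP[/= wv /sXv[//|wE]]; rewrite wE eqxx in wv.
move: sum0; rewrite (big_rem v) //= => sum0.
have av : a v \in m.
  apply: contrapT => /negP/maximal_ideal_inverse[b mb]; apply: nspan.
  have <- : - b *: (\sum_(w <- rem v s) a w *: w) + 0 = v.
    have -> : \sum_(w <- rem v s) a w *: w = - (a v *: v).
      by apply/eqP; rewrite -addr_eq0 addrC sum0.
    rewrite addr0 scalerN scaleNr opprK scalerA.
    by apply/eqP; rewrite -subr_eq0 -[X in _ - X]scale1r -scalerBl -opprB scaleNr mV0 ?oppr0.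
  by apply: span_lin => //; exact: rest_span.
move=> w ws; have [->//|wv] := eqVneq w v.
apply: (Xfree (rem v s) a _ remX); first exact: rem_uniq.
  by rewrite -[RHS]sum0 mV0 ?add0r.
by rewrite mem_rem_uniq // inE wv.
Qed.

End ResidueBasis.

(** * Lifting the basis to the limit *)

Section LiftBasis.
Variables (A : comNzRingType) (m : idealr A).

Lemma pow_submod_sub (N : lmodType A) k l : (k <= l)%N ->
  {subset (pow_submod m l : {pred N}) <= pow_submod m k}.
Proof.
move=> le_kl; apply: lspan_subset; first exact: lspan_submod_closed.
move=> _ [a [x [la _ ->]]]; apply: lspan_gen; exists a, x; split=> //.
exact: idpow_sub la.
Qed.

Lemma pow_submodZ (N : lmodType A) k l a (x : N) :
  a \in idpow m k -> x \in pow_submod m l -> a *: x \in pow_submod m (k + l).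
Proof.
move=> ka; have [P0 Plin] := pow_submod_closed m N (k + l).
apply: (@lspan_elim _ _ (fun x => a *: x \in pow_submod m (k + l))).
- by rewrite scaler0.
- by move=> c u v ua va; rewrite scalerDr scalerA mulrC -scalerA; exact: Plin.
move=> _ [c [y [lc _ ->]]]; rewrite scalerA; apply: lspan_gen.
by exists (a * c), y; split=> //; exact: idpowM.
Qed.

Variable M : nat -> lmodType A.
Variable psi : forall i, {linear M i.+1 -> M i}.
Hypothesis M_ann : forall i, annihilates (idpowS m i) (M i).
Hypothesis psi_surj : forall i y, exists x, psi i x = y.
Hypothesis psi_ker : forall i x, psi i x = 0 -> x \in pow_submod m i.+1.
Hypothesis M_triv : forall i, trivial_relations (idpowS m i) (M i).

Lemma pow_submod_ann i (x : M i) : x \in pow_submod m i.+1 -> x = 0.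
Proof.
move=> /lspanP[s sm ->]; rewrite big_seq big1 // => p /sm[a [y [ma _ ->]]].
by rewrite (M_ann y ma) scaler0.
Qed.

Fixpoint to_residue i : {linear M i -> M 0} :=
  if i is j.+1 then (to_residue j \o psi j : {linear M j.+1 -> M 0}) else idfun.

(** The kernel of each step psi_i is m^(i+1) M_(i+1), already contained in
m M_(i+1), and elements of m M_i lift to elements of m M_(i+1). *)
Lemma to_residue_ker i x : to_residue i x = 0 -> x \in pow_submod m 1.
Proof.
elim: i x => [|i IHi] x /=; first by move->; have [] := pow_submod_closed m (M 0) 1.
move/IHi; have sub := pow_submod_closed m (M i.+1) 1.
have lift y : y \in pow_submod m 1 -> exists2 z, z \in pow_submod m 1 & psi i z = y.
  move=> /lspanP[s sm ->]; elim: s sm => [|p s IHs] sm.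
    by exists 0; rewrite ?raddf0 ?big_nil ?sub.1.
  have [|z zm zE] := IHs; first by move=> q qs; apply: sm; rewrite inE qs orbT.
  have [a [y' [ma _ pE]]] := sm p (mem_head _ _); have [w wE] := psi_surj y'.
  exists (p.1 *: (a *: w) + z); last by rewrite big_cons linearP zE linearZ /= wE pE.
  by apply: sub.2 => //; apply: lspan_gen; exists a, w.
move=> /lift[z zm zE]; rewrite -[x](subrK z); apply: submodD => //.
apply: (@pow_submod_sub _ 1 i.+1) => //; apply: psi_ker.
by rewrite raddfB /= zE subrr.
Qed.

Variables (Z : choiceType) (e : Z -> M 0).
Hypothesis e_span : forall v, exists D, v = freeg_comb e D.
Hypothesis e_free : forall D, freeg_comb e D = 0 -> forall z, coeff z D \in idpow m 1.

Fixpoint basis_lift i (z : Z) : M i :=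
  if i is j.+1 return M i then sval (cid (psi_surj (basis_lift j z))) else e z.

Lemma psi_basis_lift i z : psi i (basis_lift i.+1 z) = basis_lift i z.
Proof. exact: svalP (cid (psi_surj (basis_lift i z))). Qed.

Local Notation X i := (freeg_comb (basis_lift i)).

Lemma psi_comb i D : psi i (X i.+1 D) = X i D.
Proof. exact/freeg_comb_morph/psi_basis_lift. Qed.

Lemma to_residue_comb i D : to_residue i (X i D) = freeg_comb e D.
Proof.
apply: freeg_comb_morph => z; elim: i => [|i IHi] //.
by rewrite -[LHS]/(to_residue i (psi i _)) psi_basis_lift.
Qed.

(** Nakayama's lemma for the nilpotent ideal m of A / m^(i+1): u is approximated by
combinations modulo m^k M_i for k = 0, 1, ..., i + 1. *)
Lemma lift_span i u : exists D, u = X i D.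
Proof.
have residue (w : M i) : exists D, w - X i D \in pow_submod m 1.
  have [D wD] := e_span (to_residue i w); exists D => //; apply: to_residue_ker.
  by rewrite raddfB /= to_residue_comb wD subrr.
have step k : exists D, u - X i D \in pow_submod m k.
  elim: k => [|k [D uD]].
    by exists 0; apply: lspan_gen; exists 1, (u - X i 0); rewrite scale1r.
  have [E uE] : exists E, (u - X i D) - X i E \in pow_submod m k.+1.
    have sub := pow_submod_closed m (M i) k.+1.
    move: uD; apply: (@lspan_elim _ _ (fun w => exists E, w - X i E \in pow_submod m k.+1)).
    - by exists 0; rewrite raddf0 subr0 sub.1.
    - move=> a v w [E vE] [F wF]; exists (a *: E + F).
      rewrite linearP opprD addrACA -scalerBr; exact: sub.2.
    move=> _ [a [y [ka _ ->]]]; have [E yE] := residue y; exists (a *: E).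
    by rewrite linearZ -scalerBr -addn1; exact: pow_submodZ.
  by exists (D + E); rewrite raddfD opprD addrA.
have [D uD] := step i.+1; exists D; apply/eqP; rewrite -subr_eq0; apply/eqP.
exact: pow_submod_ann.
Qed.

(** The combinations E p below express that b c is the identity modulo m: they vanish in
M_i, so their coefficients lie in m. The coefficients a of D satisfy
a = a (1 - b c) + (a b) c, where a b has entries in m^(i+1), which
improves a in m^k to a in m^(k+1). *)
Lemma lift_free i D : X i D = 0 -> forall z, coeff z D \in idpow m i.+1.
Proof.
move=> D0; pose n := size (dom D); pose zs (p : 'I_n) := tnth (in_tuple (dom D)) p.
pose a p := coeff (zs p) D.
have [|k [b [y [xE ab]]]] := M_triv (a := a) (x := fun p => basis_lift i (zs p)).
  by rewrite -[RHS]D0 freeg_combE [RHS]big_tnth.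
have [C yC] := choice (fun j => lift_span (y j)).
pose E p : {freeg Z / A} := << zs p >> - \sum_j b p j *: C j.
have Em p z : coeff z (E p) \in idpow m 1.
  apply: e_free; rewrite -(to_residue_comb i).
  suff -> : X i (E p) = 0 by rewrite raddf0.
  rewrite /E raddfB raddf_sum /= freeg_combU xE.
  by apply/eqP; rewrite subr_eq0; apply/eqP/eq_bigr => j _; rewrite linearZ /= -yC.
have coeffE z : coeff z D = \sum_p a p * coeff z (E p) +
    \sum_j (\sum_p a p * b p j) * coeff z (C j).
  rewrite -[D in LHS]freeg_sumE raddf_sum [LHS]big_tnth.
  under [Y in _ + Y]eq_bigr do rewrite mulr_suml.
  rewrite exchange_big -big_split; apply: eq_bigr => p _.
  rewrite /E !raddfB raddf_sum mulrBr mulr_sumr.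
  rewrite freeg_monomial /= coeffZ -/(a p) -[LHS]addr0 -addrA; congr (_ + _).
  rewrite addrC; apply/esym/eqP; rewrite subr_eq0; apply/eqP/eq_bigr => j _.
  by rewrite coeffZ mulrA.
have step k' : (k' <= i.+1)%N -> forall z, coeff z D \in idpow m k'.
  elim: k' => [//|k' IHk'] le_k'i z; rewrite coeffE.
  have sub := idpow_submod m k'.+1; apply: (submodD sub); apply: (submod_sum _ sub).
    by move=> p _; rewrite -addn1; apply: idpowM; [exact/IHk'/ltnW | exact: Em].
  move=> j _; rewrite mulrC; exact: (idpowZ _ (@idpow_sub _ m i.+1 _ le_k'i _ (ab j))).
exact: step.
Qed.

(** Modulo m^k a decaying function has finite support. *)
Lemma freeg_approx (f : Fdec m Z) k :
  exists D : {freeg Z / A}, forall z, (f z : A) - coeff z D \in idpow m k.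
Proof.
have /finite_seqP[s sE] := (@decayingP _ m _ f).1 (valP f) k.
exists (\sum_(z <- undup s) << (f z : A) *g z >>) => z.
have [P0 Plin] := idpow_submod m k.
have -> : coeff z (\sum_(z <- undup s) << (f z : A) *g z >>) = if z \in s then f z else 0.
  rewrite raddf_sum /=; under eq_bigr do rewrite coeffU.
  case: ifPn => zs.
    rewrite (bigD1_seq z) ?mem_undup ?undup_uniq //= eqxx mulr1 big1 ?addr0 //.
    by move=> y /negbTE ->; rewrite mulr0.
  rewrite big_seq big1 // => y; rewrite mem_undup; have [-> zs'|_ _] := eqVneq y z.
    by rewrite zs' in zs.
  by rewrite mulr0.
case: ifPn => zs; rewrite ?subrr ?subr0 //.
apply: contrapT => /negP fz; case/negP: zs.
by have : [set z | (f z : A) \notin idpow m k]%classic z by []; rewrite sE.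
Qed.

Lemma lift_comb_eq0 i D : (forall z, coeff z D \in idpow m i.+1) -> X i D = 0.
Proof. by move=> Dm; rewrite freeg_combE big1 // => z _; rewrite (M_ann _ (Dm z)). Qed.

Hypothesis A_complete : adically_complete m A^o.

(** A function f goes to the family of its sums over Z with respect to the bases of
the M_i. These sums are finite after truncation modulo m^(i+1), and the result
does not depend on the truncation. *)
Lemma Fdec_limit_iso : lmod_iso (Fdec m Z) (invlim psi).
Proof.
have /adically_completeP[sep cauchy] := A_complete.
pose T f i := sval (cid (freeg_approx f i.+1)).
have TP (f : Fdec m Z) i z : (f z : A) - coeff z (T f i) \in idpow m i.+1.
  exact: (svalP (cid (freeg_approx f i.+1))).
have evalE (f : Fdec m Z) i D : (forall z, (f z : A) - coeff z D \in idpow m i.+1) -> X i (T f i) = X i D.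
  move=> fD; apply/eqP; rewrite -subr_eq0 -[_ - _](raddfB (freeg_comb _)); apply/eqP.
  apply: lift_comb_eq0 => z; rewrite raddfB /=.
  have -> : coeff z (T f i) - coeff z D = ((f z : A) - coeff z D) - (f z - coeff z (T f i)).
    by rewrite opprB [RHS]addrC addrA subrK.
  exact: (@idpowB A m i.+1).
have compat f : (fun i => X i (T f i)) \in compatible psi.
  apply/asboolP => i; rewrite psi_comb; symmetry; apply: evalE => z.
  exact: (@idpow_sub _ m i.+2) (TP f i.+1 z).
pose Phi0 f : invlim psi := InvLim (compat f).
have Phi_lin : linear Phi0.
  move=> a f g; apply: val_inj; apply: functional_extensionality_dep => i.
  rewrite /= (@evalE _ _ (a *: T f i + T g i)) ?linearP // => z.
  rewrite coeffD coeffZ.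
  have -> : ((a *: f + g : Fdec m Z) z : A) - (a * coeff z (T f i) + coeff z (T g i)) =
      a * ((f z : A) - coeff z (T f i)) + ((g z : A) - coeff z (T g i)).
    by rewrite mulrBr opprD addrACA.
  by apply: (@idpowD A m i.+1) => //; apply: (@idpowZ A m i.+1).
pose Phi : {linear Fdec m Z -> invlim psi} := HB.pack Phi0
  (GRing.isLinear.Build A (Fdec m Z) (invlim psi) _ Phi0 Phi_lin).
exists Phi; apply: inj_surj_bijective => [f g fg|u].
  apply/eqP; rewrite -subr_eq0; apply/eqP; set h := f - g.
  have h0 : Phi h = 0 by apply/eqP; rewrite raddfB subr_eq0; apply/eqP; exact: fg.
  apply: val_inj; apply: funext => z; apply: sep => i; rewrite pow_submod_ring.
  have Xh0 : X i (T h i) = 0.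
    exact: (congr1 (fun v : invlim psi => \val v i) h0).
  rewrite -[\val h z](subrK (coeff z (T h i))).
  by apply: (@idpowD A m i.+1); [exact: TP | exact: lift_free].
have [D DP] := choice (fun i => lift_span (\val u i)).
have /asboolP u_compat := valP u.
have lim z : exists a : A, forall i, a - coeff z (D i) \in idpow m i.+1.
  have [i|a aP] := cauchy (fun i => coeff z (D i)).
    rewrite pow_submod_ring -[_ - _]raddfB; apply: lift_free.
    by rewrite raddfB /= -psi_comb -!DP u_compat subrr.
  by exists a => i; rewrite -pow_submod_ring.
have [f fP] := choice lim.
have f_dec : (f : Z -> A^o) \in decaying m (Z:=Z).
  apply/decayingP => k; apply: (@sub_finite_set _ _ [set` dom (D k)]%classic) => // z /= fz.
  apply: contrapT => /negP zD; case/negP: fz.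
  have := fP z k; rewrite (coeff_outdom zD) subr0; exact: idpow_sub.
exists (DecayingFun f_dec); apply: val_inj; apply: functional_extensionality_dep => i.
by rewrite /= (@evalE _ _ (D i)).
Qed.

End LiftBasis.

Theorem corollary4p5 (A : comNzRingType) (m : idealr A)
    (A_local : local_with m) (A_noetherian : noetherian A)
    (A_complete : adically_complete m A^o) (M : lmodType A) :
  [<-> flat M /\ adically_complete m M;
       exists S : adic_system m,
         (forall i, flat (quot_module (sys_ann S i))) /\
         lmod_iso M (invlim (sys_map S));
       adically_free m M ].
Proof.
have A_sep (a : A) : (forall i, a \in idpow m i.+1) -> a = 0.
  have /adically_completeP[sep _] := A_complete.
  by move=> a0; apply: sep => i; rewrite pow_submod_ring.
split; [|split] => /=.
- move=> [/flat_trivial_relations M_triv M_complete]; exists (adic_truncations m M).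
  split=> [i|]; first exact/flat_quotP/adic_quot_trivial_relations.
  by exists (@adic_canon A m M).
- move=> [S [S_flat MS]].
  have S_triv i : trivial_relations (idpowS m i) (sys_mod S i) := (flat_quotP _).1 (S_flat i).
  (* The maps of the system are onto, with kernel m^(i+1) M_(i+1). *)
  have S_bc i := (quot_base_changeP (@idpowS_subS A m i) (sys_ann S i.+1) (sys_ann S i)
    (sys_map S i)).1 (sys_base_change S i).
  have S_surj i := (S_bc i).1.
  have S_ker i := (S_bc i).2.
  have S0_ann : annihilates m (sys_mod S 0).
    by move=> a v ma; apply: (sys_ann S 0); rewrite [_ \in _]idpow1.
  have [Z [e [e_span e_free]]] := residue_basis A_local.1 S0_ann.
  exists Z; have [|f [g [fK gK]]] := @lmod_iso_inv _ (Fdec m Z) (invlim (sys_map S)).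
    apply: (Fdec_limit_iso (sys_ann S) S_surj S_ker S_triv e_span _ A_complete).
    by move=> D /e_free De z; rewrite idpow1.
  have [h [k [hK kK]]] := lmod_iso_inv MS.
  exists (g \o h : {linear M -> Fdec m Z}).
  by exists (k \o f) => x /=; rewrite ?gK ?hK ?kK ?fK.
move=> [Z MZ]; split.
  by apply/trivial_relations_flat/(lmod_iso_trivial_relations MZ)/Fdec_trivial_relations.
by apply: (lmod_iso_complete MZ); apply: Fdec_complete.
Qed.
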